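(* Work in a structure of finite Morley rank. Let $\mathfrak{g}$ be a Lie ring of finite Morley rank (not necessarily connected). Let $V$ be a definable, irreducible, faithful $\mathfrak{g}$-module. Suppose that the characteristic of $V$ satisfies $\operatorname{char} V > \operatorname{RM}(V)$, where $\operatorname{RM}$ denotes Morley rank. Suppose that $\mathfrak{g}$ has an infinite abelian ideal $\mathfrak{a} \trianglelefteq \mathfrak{g}$. Then $\mathfrak{a} \subseteq Z(\mathfrak{g})$, and the configuration is definably linear: there is an infinite field $\mathbb{K}$ such that $V$ is a $\mathbb{K}$-vector space, $\mathfrak{g}$ embeds into the Lie ring $\mathfrak{gl}(V)$ of $\mathbb{K}$-linear endomorphisms of $V$, and, under this embedding, $\mathfrak{a}$ embeds into the scalars $\mathbb{K}\operatorname{Id}_V$, all definably.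
   Context: A Lie ring is an abelian group $(\mathfrak{g};+)$ with a biadditive bracket $[\cdot,\cdot]$ satisfying $[x,x]=0$ and the Jacobi identity. A Lie ring of finite Morley rank is a Lie ring definable in a structure of finite Morley rank; definability refers to this ambient structure, in which the modules considered are also definable. $Z(\mathfrak{g})=\{x\in\mathfrak{g}:[x,y]=0 \text{ for all } y\in\mathfrak{g}\}$. An ideal is an additive subgroup $\mathfrak{a}$ with $[\mathfrak{g},\mathfrak{a}]\subseteq\mathfrak{a}$ (not assumed definable); it is abelian if $[\mathfrak{a},\mathfrak{a}]=0$. A definable group is connected if it has no proper definable subgroup of finite index. For an abelian group $V$, $\operatorname{End}(V)$ is regarded as a Lie ring under $[f,g]=f\circ g-g\circ f$. An action of $\mathfrak{g}$ on $V$ is a Lie ring morphism $\rho\colon\mathfrak{g}\to\operatorname{End}(V)$; it is faithful if $\rho$ is injective, and definable if $(\mathfrak{g};+,[\cdot,\cdot])$, $(V;+)$ and the map $\mathfrak{g}\times V\to V$, $(g,v)\mapsto\rho(g)(v)$, are definable. A definable $\mathfrak{g}$-module is a definable, connected abelian group $V$ with a definable action of $\mathfrak{g}$. It is irreducible if $V$ has no definable, connected, non-trivial, proper, $\mathfrak{g}$-invariant subgroup. An irreducible definable module either has $(V;+)$ of prime exponent $p$, in which case its characteristic is $p$, or has $(V;+)$ divisible, in which case its characteristic is $0$. ''All definably'' means that the field $\mathbb{K}$, its vector space structure on $V$, and the embeddings in question are definable; the action of $\mathfrak{g}$ on $V$ is the one induced by the embedding $\mathfrak{g}\hookrightarrow\mathfrak{gl}(V)$.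 *)

(* Defs.v *)
From HB Require Import structures.
From mathcomp Require Import all_boot all_order all_algebra.
From mathcomp Require Import boolp classical_sets functions cardinality.

Set Implicit Arguments.
Unset Strict Implicit.
Unset Printing Implicit Defensive.

Import GRing.Theory.
Local Open Scope classical_set_scope.
Local Open Scope ring_scope.

(** * First-order structures *)

Record language := Language {
  fun_sym : Type;
  fun_ar : fun_sym -> nat;
  rel_sym : Type;
  rel_ar : rel_sym -> nat
}.

Record structure (L : language) := Structure {
  carrier :> Type;
  fun_interp : forall f : fun_sym L, (fun_ar f).-tuple carrier -> carrier;
  rel_interp : forall r : rel_sym L, (rel_ar r).-tuple carrier -> Prop
}.

Inductive term (L : language) : Type :=
| Var of nat
| Fun (f : fun_sym L) of ('I_(fun_ar f) -> term L).

(* Variables are de Bruijn indices; [All] binds index 0. *)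
Inductive formula (L : language) : Type :=
| Bot
| Eq of term L & term L
| Rel (r : rel_sym L) of ('I_(rel_ar r) -> term L)
| Imp of formula L & formula L
| All of formula L.

Section Semantics.
Variables (L : language) (M : structure L).

Fixpoint eval (e : nat -> M) (t : term L) : M :=
  match t with
  | Var i => e i
  | Fun f args => fun_interp (mktuple (fun i => eval e (args i)))
  end.

Definition env_cons (x : M) (e : nat -> M) : nat -> M :=
  fun i => if i is j.+1 then e j else x.

Fixpoint sat (e : nat -> M) (phi : formula L) : Prop :=
  match phi with
  | Bot => False
  | Eq t u => eval e t = eval e u
  | Rel r args => rel_interp (mktuple (fun i => eval e (args i)))
  | Imp phi psi => sat e phi -> sat e psi
  | All phi => forall x, sat (env_cons x e) phi
  end.

(* The variables 0, ..., n-1 range over M^n, the variables i >= n are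
   parameters with value e i. *)
Definition solutions (n : nat) (phi : formula L) (e : nat -> M) :
  set (n.-tuple M) := [set t : n.-tuple M | sat (fun i => nth (e i) t i) phi].

Definition definable (n : nat) (X : set (n.-tuple M)) : Prop :=
  exists (phi : formula L) (e : nat -> M), X = solutions phi e.

(* The finite parameter set is the range of e. A type is given by a set Gamma
   of formulas in the variables 0, ..., n-1, with parameters e i for i >= n. *)
Definition aleph0_saturated : Prop :=
  forall (n : nat) (e : nat -> M) (Gamma : set (formula L)),
    finite_set (range e) ->
    (forall Delta : set (formula L), finite_set Delta -> Delta `<=` Gamma ->
       exists t : n.-tuple M, forall phi, Delta phi -> solutions phi e t) ->
    exists t : n.-tuple M, forall phi, Gamma phi -> solutions phi e t.

Fixpoint rank_ge_in (n k : nat) (X : set (n.-tuple M)) : Prop :=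
  if k is k'.+1 then
    exists Y : nat -> set (n.-tuple M),
      [/\ forall i, definable (Y i), trivIset [set: nat] Y,
          forall i, Y i `<=` X & forall i, rank_ge_in k' (Y i)]
  else X !=set0.

End Semantics.

Definition elementary_embedding (L : language) (M N : structure L)
    (f : M -> N) : Prop :=
  forall (e : nat -> M) (phi : formula L), sat (f \o e) phi <-> sat e phi.

(* Morley rank of a definable set is computed after passing to an
   aleph_0-saturated elementary extension; the choice of phi, e, N and f is
   irrelevant. *)
Definition morley_rank_ge (L : language) (M : structure L) (n k : nat)
    (X : set (n.-tuple M)) : Prop :=
  exists (phi : formula L) (e : nat -> M), X = solutions phi e /\
  exists (N : structure L) (f : M -> N),
    [/\ elementary_embedding f, aleph0_saturated N
      & rank_ge_in k (@solutions L N n phi (f \o e))].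

Definition morley_rank (L : language) (M : structure L) (n : nat)
    (X : set (n.-tuple M)) (r : nat) : Prop :=
  morley_rank_ge r X /\ ~ morley_rank_ge r.+1 X.

Definition finite_morley_rank (L : language) (M : structure L) : Prop :=
  exists r, morley_rank [set: 1.-tuple M] r.

(** * Definability on abstract types *)

(* An identification of the abstract type T with a subset of some M^n;
   notions of definability on T are relative to it. *)
Record coordinates (L : language) (M : structure L) (T : Type) := Coordinates {
  coord_dim : nat;
  coord :> T -> coord_dim.-tuple M;
  coord_inj : injective coord
}.

Section Definability.
Variables (L : language) (M : structure L).

Definition coord_pair_fun (S T : Type) (cS : coordinates M S)
    (cT : coordinates M T) (u : S * T) :
    (coord_dim cS + coord_dim cT).-tuple M := cat_tuple (cS u.1) (cT u.2).

Lemma coord_pair_inj (S T : Type) (cS : coordinates M S)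
  (cT : coordinates M T) : injective (coord_pair_fun cS cT).
Proof.
move=> [s t] [s' t'] /(congr1 val) /= E.
have Es := congr1 (take (coord_dim cS)) E.
have Et := congr1 (drop (coord_dim cS)) E.
rewrite !take_size_cat ?size_tuple// in Es.
rewrite !drop_size_cat ?size_tuple// in Et.
by rewrite (coord_inj (val_inj Es)) (coord_inj (val_inj Et)).
Qed.

Definition coord_pair (S T : Type) (cS : coordinates M S)
    (cT : coordinates M T) : coordinates M (S * T)%type :=
  Coordinates (@coord_pair_inj S T cS cT).

Definition definable_in (T : Type) (c : coordinates M T) (A : set T) : Prop :=
  definable (c @` A).

Definition definable_fun (S T : Type) (cS : coordinates M S)
    (cT : coordinates M T) (f : S -> T) : Prop :=
  definable_in (coord_pair cS cT) [set u | f u.1 = u.2].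

Definition definable_fun2 (S T U : Type) (cS : coordinates M S)
    (cT : coordinates M T) (cU : coordinates M U) (f : S -> T -> U) : Prop :=
  definable_fun (coord_pair cS cT) cU (fun u => f u.1 u.2).

Definition definable_group (V : zmodType) (c : coordinates M V) : Prop :=
  definable_in c [set: V] /\ definable_fun2 c c c +%R.

Definition definable_field (K : fieldType) (c : coordinates M K) : Prop :=
  definable_group c /\ definable_fun2 c c c *%R.

Definition subgroup (V : zmodType) (H : set V) : Prop :=
  H 0 /\ forall x y, H x -> H y -> H (x - y).

Definition finite_index (V : zmodType) (H W : set V) : Prop :=
  exists s : seq V, forall w, W w -> exists2 u, u \in s & H (w - u).

Definition connected (V : zmodType) (c : coordinates M V) (W : set V) : Prop :=
  forall H : set V, subgroup H -> definable_in c H -> H `<=` W ->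
    finite_index H W -> H = W.

End Definability.

(** * Lie rings and their modules *)

HB.mixin Record Zmodule_isLieRing g of GRing.Zmodule g := {
  bracket : g -> g -> g;
  bracketDl : forall x y z, bracket (x + y) z = bracket x z + bracket y z;
  bracketDr : forall x y z, bracket x (y + z) = bracket x y + bracket x z;
  bracketxx : forall x, bracket x x = 0;
  jacobi : forall x y z,
    bracket x (bracket y z) + bracket y (bracket z x)
      + bracket z (bracket x y) = 0
}.

#[short(type="lieRingType")]
HB.structure Definition LieRing := {g of GRing.Zmodule g & Zmodule_isLieRing g}.

Section LieRings.
Variable g : lieRingType.

Definition lie_center : set g := [set x | forall y, bracket x y = 0].

Definition lie_ideal (a : set g) : Prop :=
  subgroup a /\ forall x y, a y -> a (bracket x y).

Definition lie_abelian (a : set g) : Prop :=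
  forall x y, a x -> a y -> bracket x y = 0.

Definition lie_action (V : zmodType) (rho : g -> {additive V -> V}) : Prop :=
  (forall x y v, rho (x + y) v = rho x v + rho y v) /\
  (forall x y v, rho (bracket x y) v = rho x (rho y v) - rho y (rho x v)).

Definition faithful (V : zmodType) (rho : g -> {additive V -> V}) : Prop :=
  forall x y, rho x =1 rho y -> x = y.

End LieRings.

Arguments lie_center : clear implicits.

Section Modules.
Variables (L : language) (M : structure L).

Definition definable_lie_ring (g : lieRingType) (c : coordinates M g) : Prop :=
  definable_group c /\ definable_fun2 c c c (@bracket g).

Definition definable_action (g : lieRingType) (V : zmodType)
    (cg : coordinates M g) (cV : coordinates M V)
    (rho : g -> {additive V -> V}) : Prop :=
  [/\ definable_lie_ring cg, definable_group cV, lie_action rho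
    & definable_fun2 cg cV cV (fun x v => rho x v)].

Definition definable_module (g : lieRingType) (V : zmodType)
    (cg : coordinates M g) (cV : coordinates M V)
    (rho : g -> {additive V -> V}) : Prop :=
  definable_action cg cV rho /\ connected cV [set: V].

Definition irreducible_module (g : lieRingType) (V : zmodType)
    (cV : coordinates M V) (rho : g -> {additive V -> V}) : Prop :=
  forall W : set V, subgroup W -> definable_in cV W -> connected cV W ->
    (forall x w, W w -> W (rho x w)) -> W = [set 0] \/ W = [set: V].

End Modules.

Definition module_char (V : zmodType) (p : nat) : Prop :=
  [/\ prime p, (exists v : V, v != 0) & forall v : V, v *+ p = 0] \/
  (p = 0%N /\ forall (n : nat) (v : V), (0 < n)%N -> exists w : V, w *+ n = v).

(** * Definable linearity *)

Record scaling (K : fieldType) (V : zmodType) := Scaling {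
  scale :> K -> V -> V;
  scale_assoc : forall a b v, scale a (scale b v) = scale (a * b) v;
  scale_1 : left_id 1 scale;
  scale_addr : right_distributive scale +%R;
  scale_addl : forall v, {morph scale^~ v : a b / a + b}
}.

(* The group V, equipped with the K-vector space structure s. *)
Definition vector_space (K : fieldType) (V : zmodType) (s : scaling K V) :
  Type := V.

HB.instance Definition _ (K : fieldType) (V : zmodType) (s : scaling K V) :=
  GRing.Zmodule.on (vector_space s).

HB.instance Definition _ (K : fieldType) (V : zmodType) (s : scaling K V) :=
  GRing.Zmodule_isLmodule.Build K (vector_space s)
    (scale_assoc s) (scale_1 s) (scale_addr s) (scale_addl s).

(* [a] need not be definable: the embedding of [a] into the scalars is the
   restriction of a definable map [lambda] on g. *)
Definition definably_linear (L : language) (M : structure L)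
    (g : lieRingType) (V : zmodType) (cg : coordinates M g)
    (cV : coordinates M V) (rho : g -> {additive V -> V}) (a : set g) : Prop :=
  exists (K : fieldType) (cK : coordinates M K)
    (s : scaling K V),
    let VK := vector_space s in
    [/\ infinite_set [set: K], definable_field cK,
        definable_fun2 cK cV cV (fun (k : K) (v : VK) => k *: v)
      & exists iota : g -> {linear VK -> VK},
        [/\ definable_action cg cV (fun x => iota x : {additive VK -> VK}),
            faithful (fun x => iota x : {additive VK -> VK}),
            forall x v, iota x v = rho x v
          & exists2 lambda : g -> K, definable_fun cg cK lambda
              & forall x, a x -> forall v : VK, iota x v = lambda x *: v]].

(* Main.v *)
Require Import Defs.
From HB Require Import structures.
From mathcomp Require Import all_boot all_order all_algebra.
From mathcomp Require Import boolp classical_sets functions cardinality.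

(* Everything takes place in the commutative ring R of endomorphisms of V
   generated by a definable abelian ideal containing a, namely the center of
   the centralizer of a.  Since [x, f^n] = n f^(n-1) [x, f] for x in g and f in
   R, the power f^p commutes with g, so Schur's lemma makes every f in R either
   nilpotent or surjective with finite kernel.  If f is nilpotent and u = [x, f]
   is not, then f^n = 0 with 0 < n < p would give n f^(n-1) u = 0, hence
   f^(n-1) = 0; so the images of 1, f, ..., f^(p-1) form a strictly decreasing
   chain of connected groups, of length p > RM(V).  Hence ad x preserves the
   nilpotent elements, their annihilator in V is g-invariant, and R is a domain.

   On a minimal infinite definable R-submodule W, the ring R acts simply
   transitively away from 0: for w in W, a sum of finitely many groups f_i (b w),
   b the connected component of the ideal, is R-invariant, so it is W as soon as
   b w <> 0; and w with b w = 0 vanish because they form a finite group.  So R is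
   a definable field in bijection with W.  By the chain condition this field is
   perfect, so all its elements are p-th powers and commute with g.

   The chain condition on V comes from its finite rank.  For g it comes from an
   embedding into a finite power of V: if no finite part of V had trivial
   annihilator in g, the relation x v = 0 would have an infinite ladder, which
   aleph_0-saturation turns into infinite rank of V. *)

Set Implicit Arguments.
Unset Strict Implicit.
Unset Printing Implicit Defensive.

Import GRing.Theory.
Local Open Scope classical_set_scope.
Local Open Scope ring_scope.

(** * Renaming of variables and satisfaction of formulas *)

Section Syntax.
Variable L : language.

Fixpoint trename (s : nat -> nat) (t : term L) : term L :=
  match t with
  | Var i => Var L (s i)
  | Defs.Fun f args => Defs.Fun (fun i => trename s (args i))
  end.

Definition up (s : nat -> nat) (i : nat) : nat :=
  if i is j.+1 then (s j).+1 else 0%N.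

Fixpoint rename (s : nat -> nat) (phi : formula L) : formula L :=
  match phi with
  | Bot => Bot L
  | Eq t u => Eq (trename s t) (trename s u)
  | Rel r args => Rel (fun i => trename s (args i))
  | Imp phi psi => Imp (rename s phi) (rename s psi)
  | All phi => All (rename (up s) phi)
  end.

Definition Not (phi : formula L) := Imp phi (Bot L).
Definition And (phi psi : formula L) := Not (Imp phi (Not psi)).
Definition Ex (phi : formula L) := Not (All (Not phi)).

Variable S : structure L.
Implicit Types e : nat -> S.

Lemma eval_rename s (t : term L) e : eval e (trename s t) = eval (e \o s) t.
Proof.
elim: t => [//|f args IH] /=; congr (fun_interp _).
by apply: eq_from_tnth => i; rewrite !tnth_mktuple.
Qed.

Lemma env_cons_up s (x : S) e : env_cons x e \o up s = env_cons x (e \o s).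
Proof. by apply/funext => -[]. Qed.

Lemma sat_rename s phi e : sat e (rename s phi) <-> sat (e \o s) phi.
Proof.
elim: phi s e => [|t u|r args|phi IH psi IH'|phi IH] s e //=.
- by rewrite !eval_rename.
- suff -> : mktuple (fun i => eval e (trename s (args i))) =
            mktuple (fun i => eval (e \o s) (args i)) by [].
  by apply: eq_from_tnth => i; rewrite !tnth_mktuple eval_rename.
- by rewrite IH IH'.
- by split=> H x; have := H x; rewrite IH env_cons_up.
Qed.

Lemma sat_not e phi : sat e (Not phi) <-> ~ sat e phi.
Proof. by []. Qed.

Lemma sat_and e phi psi : sat e (And phi psi) <-> sat e phi /\ sat e psi.
Proof.
rewrite /=; split=> [H|[H H'] /(_ H)/(_ H')//].
by split; apply: contrapT => H'; apply: H => // h1 h2.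
Qed.

Lemma sat_ex e phi : sat e (Ex phi) <-> exists x, sat (env_cons x e) phi.
Proof.
rewrite /=; split=> [H|[x H] /(_ x)/(_ H)//].
by apply: contrapT => H'; apply: H => x h; apply: H'; exists x.
Qed.

Definition env_app (s : seq S) e (i : nat) : S :=
  if (i < size s)%N then nth (e i) s i else e (i - size s)%N.

Lemma env_app_nil e : env_app [::] e = e.
Proof. by apply/funext => i; rewrite /env_app /= subn0. Qed.

Lemma env_app_rcons s x e : env_app (rcons s x) e = env_app s (env_cons x e).
Proof.
apply/funext => i; rewrite /env_app size_rcons ltnS nth_rcons leq_eqVlt.
case: (ltngtP i (size s)) => //=.
- by move=> lt_is; apply: set_nth_default.
- move=> lt_si; have [k ->] : exists k, i = (size s + k.+1)%N.
    by exists (i - (size s).+1)%N; rewrite addnS -addSn subnKC.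
  by rewrite -addSnnS addKn addSnnS addKn.
- by move=> ->; rewrite subnn.
Qed.

(** The innermost quantifier owns index 0, so the outermost one binds the last coordinate; the
    induction therefore peels the tuple from the right. *)
Lemma sat_iter_ex n e phi :
  sat e (iter n Ex phi) <-> exists t : n.-tuple S, sat (env_app t e) phi.
Proof.
elim: n e => [|n IH] e.
  split=> [h|[t]]; first by exists [tuple]; rewrite env_app_nil.
  by rewrite tuple0 env_app_nil.
rewrite iterS sat_ex; split=> [[x /IH [t h]]|[t h]].
  by exists [tuple of rcons t x]; rewrite /= env_app_rcons.
case: t h => s; case/lastP: s => [|s x] sz //= h.
have sz' : size s == n by move: sz; rewrite size_rcons eqSS.
by exists x; apply/IH; exists (Tuple sz'); rewrite -env_app_rcons.
Qed.

End Syntax.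

Lemma eval_bound (L : language) (t : term L) : exists B : nat,
  forall (S : structure L) (e e' : nat -> S),
    (forall i, (i < B)%N -> e i = e' i) -> eval e t = eval e' t.
Proof.
elim: t => [i|f args IH].
  by exists i.+1 => S e e' /(_ i (ltnSn i)).
have [B HB] := choice IH.
exists (\max_(i < fun_ar f) B i) => S e e' ee' /=; congr (fun_interp _).
apply: eq_from_tnth => i; rewrite !tnth_mktuple.
apply: HB => j lt_j; apply: ee'; apply: leq_trans lt_j _.
exact: (leq_bigmax i).
Qed.

(** The bound is the same in all structures, so parameters beyond it can be replaced simultaneously
    in a structure and in its extension. This produces the finite parameter sets that saturation
    asks for. *)
Lemma sat_bound (L : language) (phi : formula L) : exists B : nat,
  forall (S : structure L) (e e' : nat -> S),
    (forall i, (i < B)%N -> e i = e' i) -> sat e phi <-> sat e' phi.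
Proof.
elim: phi => [|t u|r args|phi [B HB] psi [B' HB']|phi [B HB]].
- by exists 0%N.
- have [B HB] := eval_bound t; have [B' HB'] := eval_bound u.
  exists (maxn B B') => S e e' ee' /=.
  rewrite (HB _ e e') ?(HB' _ e e') // => i lt_i; apply: ee';
    by rewrite leq_max lt_i ?orbT.
- have [B HB] := choice (fun i => eval_bound (args i)).
  exists (\max_(i < rel_ar r) B i) => S e e' ee' /=.
  suff -> : mktuple (fun i => eval e (args i)) =
            mktuple (fun i => eval e' (args i)) by [].
  apply: eq_from_tnth => i; rewrite !tnth_mktuple.
  apply: HB => j lt_j; apply: ee'; apply: leq_trans lt_j _.
  exact: (leq_bigmax i).
- exists (maxn B B') => S e e' ee' /=.
  rewrite (HB _ e e') ?(HB' _ e e') // => i lt_i; apply: ee';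
    by rewrite leq_max lt_i ?orbT.
- exists B => S e e' ee' /=.
  have H x : sat (env_cons x e) phi <-> sat (env_cons x e') phi.
    by apply: HB => -[//|i] lt_i /=; apply: ee'; apply: ltnW.
  by split=> h x; apply/H.
Qed.

(** Interleaving packs two infinite environments into one without fixing how many positions either
    of them uses. *)
Definition mix (T : Type) (e p : nat -> T) (i : nat) : T :=
  if odd i then p i./2 else e i./2.

Lemma mixD T (e p : nat -> T) i : mix e p i.*2 = e i.
Proof. by rewrite /mix odd_double doubleK. Qed.

Lemma mixDS T (e p : nat -> T) i : mix e p i.*2.+1 = p i.
Proof. by rewrite /mix /= odd_double /= uphalf_double. Qed.

Lemma comp_mix T U (f : T -> U) (e p : nat -> T) :
  f \o mix e p = mix (f \o e) (f \o p).
Proof. by apply/funext => i; rewrite /mix /=; case: odd. Qed.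

Lemma nat_parity_ind (P : nat -> Prop) :
  (forall i, P i.*2) -> (forall i, P i.*2.+1) -> forall i, P i.
Proof.
move=> P0 P1 i; rewrite -(odd_double_half i).
by case: odd; rewrite ?add1n ?add0n.
Qed.

(** * Morley rank under elementary extensions *)

Section Transfer.
Variables (L : language) (M N : structure L) (f : M -> N).
Hypothesis f_el : elementary_embedding f.

Definition incl_formula n (phi psi : formula L) : formula L :=
  Not (iter n (@Ex L) (And
    (rename (fun i => if (i < n)%N then i else (n + i.*2)%N) phi)
    (Not (rename (fun i => if (i < n)%N then i else (n + i.*2.+1)%N) psi)))).

Lemma sat_incl_formula (S : structure L) n phi psi (e e' : nat -> S) :
  sat (mix e e') (incl_formula n phi psi) <->
  @solutions L S n phi e `<=` solutions psi e'.
Proof.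
rewrite /incl_formula sat_not sat_iter_ex.
have E (t : n.-tuple S) : env_app t (mix e e') \o
    (fun i => if (i < n)%N then i else (n + i.*2)%N) =
    fun i => nth (e i) t i.
  apply/funext => i /=; rewrite /env_app size_tuple.
  case: (ltnP i n) => ni; first by rewrite ni; apply: set_nth_default; rewrite size_tuple.
  by rewrite ltnNge leq_addr /= addKn mixD nth_default // size_tuple.
have E' (t : n.-tuple S) : env_app t (mix e e') \o
    (fun i => if (i < n)%N then i else (n + i.*2.+1)%N) =
    fun i => nth (e' i) t i.
  apply/funext => i /=; rewrite /env_app size_tuple.
  case: (ltnP i n) => ni; first by rewrite ni; apply: set_nth_default; rewrite size_tuple.
  by rewrite ltnNge leq_addr /= addKn mixDS nth_default // size_tuple.
split=> [H t ht|H [t]].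
  apply: contrapT => ht'; apply: H; exists t.
  by rewrite sat_and sat_not !sat_rename E E'.
by rewrite sat_and sat_not !sat_rename E E' => -[/H].
Qed.

(** Inclusion is the only relation that has to be transferred: emptiness is inclusion in [Bot], and
    disjointness is inclusion in a negation. *)
Lemma solutions_transfer n phi psi (e e' : nat -> M) :
  @solutions L M n phi e `<=` solutions psi e' <->
  @solutions L N n phi (f \o e) `<=` solutions psi (f \o e').
Proof. by rewrite -!sat_incl_formula -comp_mix f_el. Qed.

(** The formulas of the disjoint pieces are reread in [N] at the images of their parameters. Hence a
    rank witnessed by sets definable in [M] is a lower bound in the saturated extension. *)
Lemma rank_ge_transfer n k phi (e : nat -> M) :
  rank_ge_in k (@solutions L M n phi e) ->
  rank_ge_in k (@solutions L N n phi (f \o e)).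
Proof.
elim: k phi e => [|k IH] phi e /=.
  move=> [t ht]; apply: contrapT => H.
  have /solutions_transfer/(_ t ht) // :
    @solutions L N n phi (f \o e) `<=` solutions (Bot L) (f \o e).
  by move=> u hu; apply: H; exists u.
move=> [Y [Ydef Ydisj Ysub Yrk]].
have [psi H] := choice Ydef; have [q Yq] := choice H.
exists (fun i => solutions (psi i) (f \o q i)); split.
- by move=> i; exists (psi i), (f \o q i).
- move=> i j _ _ [t [hi hj]]; apply: contrapT => /eqP neq_ij.
  have /solutions_transfer/(_ t hi)/(_ hj) // :
    @solutions L M n (psi i) (q i) `<=` solutions (Not (psi j)) (q j).
  move=> u hu hu'; case/eqP: neq_ij; apply: (Ydisj i j) => //.
  by exists u; split; rewrite Yq.
- move=> i; have := Ysub i; rewrite Yq.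
  by case: (@solutions_transfer n (psi i) phi (q i) e) => + _; apply.
- by move=> i; apply: IH; rewrite -Yq.
Qed.

End Transfer.

(** * Ladders in sets of finite rank *)

(* Complete binary trees of instances of [R]: [tree R k X] says that the
   2-rank of [X] with respect to [R] is at least [k]. *)
Fixpoint tree (A B : Type) (R : B -> set A) (k : nat) (X : set A) : Prop :=
  if k is k'.+1 then exists b, tree R k' (X `&` R b) /\ tree R k' (X `\` R b)
  else X !=set0.

Lemma tree_sub A B (R : B -> set A) k X Y : X `<=` Y -> tree R k X -> tree R k Y.
Proof.
elim: k X Y => [|k IH] X Y XY /=; first by move=> [x /XY]; exists x.
by move=> [b [h1 h2]]; exists b; split; [move: h1|move: h2];
  apply: IH => x [/XY].
Qed.

Lemma tree_le A B (R : B -> set A) j k X : (j <= k)%N -> tree R k X -> tree R j X.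
Proof.
move=> /subnK <-; elim: (k - j)%N => [//|d IH] [b [h _]].
by apply: IH; move: h; apply: tree_sub => x [].
Qed.

(** An interval of length [2 ^ k.+1] of the ladder is cut in the middle: the instance at the last
    index of the first half contains exactly that half. *)
Lemma ladder_tree A B (R : B -> set A) (X : set A) (t : nat -> A)
    (b : nat -> B) lo k :
  (forall i, (lo <= i < lo + 2 ^ k)%N -> X (t i)) ->
  (forall i j, R (b j) (t i) <-> (i <= j)%N) ->
  tree R k X.
Proof.
move=> Xt Rbt; elim: k lo X Xt => [|k IH] lo X Xt /=.
  by exists (t lo); apply: Xt; rewrite leqnn /= addn1.
have pk : (0 < 2 ^ k)%N by rewrite expn_gt0.
exists (b (lo + 2 ^ k).-1); split; [apply: (IH lo)|apply: (IH (lo + 2 ^ k)%N)].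
  move=> i /andP[h1 h2]; split; last by apply/Rbt; case: (_ + _)%N h2.
  apply: Xt; rewrite h1 /=; apply: leq_trans h2 _.
  by rewrite leq_add2l leq_pexp2l.
move=> i /andP[h1 h2]; split; last first.
  by move/Rbt; rewrite leqNgt prednK ?h1 // addn_gt0 pk orbT.
apply: Xt; rewrite (leq_trans _ h1) ?leq_addr //=.
by rewrite expnS mul2n -addnn addnA.
Qed.

(** * Existence of a tree of given height as a first-order formula *)

Section TreeFormula.
Variables (L : language) (m n : nat) (phi : formula L).

(* [phi] has the point in its first [m] variables, the index of the instance
   in the next [n] ones, and parameters afterwards. *)
Definition instances (S : structure L) (q : nat -> S) (b : n.-tuple S) :
  set (m.-tuple S) := [set t | sat (env_app t (env_app b q)) phi].

(** Skips the [d] index blocks bound earlier, which lie between the current index and the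
    parameters. *)
Definition shift_params d : formula L :=
  rename (fun i => if (i < m + n)%N then i else (i + d * n)%N) phi.

Definition weaken (Y : formula L) : formula L :=
  rename (fun i => if (i < m)%N then i else (i + n)%N) Y.

(* The parameters start at [d * n] in the environment, after [d] indices. *)
Fixpoint tree_formula (d k : nat) (Y : formula L) : formula L :=
  if k is k'.+1 then
    iter n (@Ex L) (And
      (tree_formula d.+1 k' (And (weaken Y) (shift_params d)))
      (tree_formula d.+1 k' (And (weaken Y) (Not (shift_params d)))))
  else iter m (@Ex L) Y.

Variable S : structure L.
Implicit Types e q : nat -> S.

Definition slice e (Y : formula L) : set (m.-tuple S) :=
  [set t : m.-tuple S | sat (env_app t e) Y].

Lemma sat_weaken (t : m.-tuple S) (b : n.-tuple S) e Y :
  sat (env_app t (env_app b e)) (weaken Y) <-> sat (env_app t e) Y.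
Proof.
rewrite /weaken sat_rename; suff -> : env_app t (env_app b e) \o
  (fun i => if (i < m)%N then i else (i + n)%N) = env_app t e by [].
apply/funext => i; rewrite /env_app /= !size_tuple.
case: (ltnP i m) => im; first by rewrite im; apply: set_nth_default; rewrite size_tuple.
have mi : (i + n < m)%N = false by rewrite ltnNge (leq_trans im) ?leq_addr.
by rewrite mi -addnBAC // ltnNge leq_addl /= addnK.
Qed.

Lemma sat_shift_params (t : m.-tuple S) (b : n.-tuple S) e q d :
  (forall i, e (d * n + i)%N = q i) ->
  sat (env_app t (env_app b e)) (shift_params d) <-> instances q b t.
Proof.
move=> eq_eq; rewrite /shift_params sat_rename /instances /mkset.
suff -> : env_app t (env_app b e) \o
  (fun i => if (i < m + n)%N then i else (i + d * n)%N) =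
  env_app t (env_app b q) by [].
apply/funext => i; rewrite /env_app /= !size_tuple.
case: (ltnP i (m + n)) => imn.
  case: ltnP => im; first by apply: set_nth_default; rewrite size_tuple.
  by rewrite ltn_subLR // imn; apply: set_nth_default; rewrite size_tuple ltn_subLR.
have im : (m <= i)%N by apply: leq_trans imn; apply: leq_addr.
have -> : (i + d * n < m)%N = false.
  by rewrite ltnNge (leq_trans im) ?leq_addr.
rewrite [(i < m)%N]ltnNge im /= !ltn_subLR // ?(leq_trans im (leq_addr _ _)) //.
rewrite [(i < m + n)%N]ltnNge imn /=.
rewrite [(_ + _ < _)%N]ltnNge (leq_trans imn (leq_addr _ _)) /= -eq_eq.
by congr e; rewrite -!subnDA -addnBAC // addnC.
Qed.

Lemma sat_tree_formula e q d k Y :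
  (forall i, e (d * n + i)%N = q i) ->
  sat e (tree_formula d k Y) <-> tree (instances q) k (slice e Y).
Proof.
elim: k d e Y => [|k IH] d e Y eq_eq; cbn [tree_formula tree].
  by rewrite sat_iter_ex.
rewrite sat_iter_ex.
have eq' (b : n.-tuple S) i : env_app b e (d.+1 * n + i)%N = q i.
  by rewrite /env_app size_tuple mulSn -addnA ltnNge leq_addr /= addKn.
have E (b : n.-tuple S) : slice (env_app b e) (And (weaken Y) (shift_params d)) =
           slice e Y `&` instances q b.
  apply/seteqP; split=> t; rewrite /slice /mkset sat_and sat_weaken
    (sat_shift_params _ _ eq_eq) //.
have E' (b : n.-tuple S) : slice (env_app b e) (And (weaken Y) (Not (shift_params d))) =
           slice e Y `\` instances q b.
  apply/seteqP; split=> t; rewrite /slice /mkset sat_and sat_weaken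
    sat_not (sat_shift_params _ _ eq_eq) //.
by split=> -[b]; [move/sat_and|] => H; exists b; [|apply/sat_and];
   move: H; rewrite !(IH d.+1 (env_app b e)) // E E'.
Qed.

End TreeFormula.

(** * Trees of all heights in a saturated structure force infinite rank *)

Section NoLadder.
Variables (L : language) (m n : nat) (phi : formula L) (N : structure L).
Hypothesis N_sat : aleph0_saturated N.
Variable q : nat -> N.

(** The first clause keeps finitely many parameters, as saturation requires, with [q] at an offset
    [d * n] so that [tree_formula] applies at depth [d]. *)
Definition big (X : set (m.-tuple N)) : Prop :=
  (exists d e Y, [/\ forall i, e (d * n + i)%N = q i, finite_set (range e)
                   & X = @slice L m _ e Y]) /\
  forall k, tree (@instances L m n phi N q) k X.

Lemma finite_sub_range (T : Type) (F : nat -> T) (D : set T) :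
  finite_set D -> D `<=` range F ->
  exists K, D `<=` F @` [set k | (k <= K)%N].
Proof.
elim/Pchoice: T F D => T F D /finite_seqP[s ->].
elim: s => [|x s IH] sub; first by exists 0%N.
have [|K HK] := IH; first by move=> y ys; apply: sub; rewrite /= inE orbC ys.
have [|k _ Fk] := sub x; first by rewrite /= inE eqxx.
exists (maxn k K) => y /=; rewrite inE => /orP[/eqP->|/HK[j /= jK <-]].
  by exists k => //=; rewrite leq_max leqnn.
by exists j => //=; rewrite leq_max jK orbT.
Qed.

Lemma range_env_app (s : seq N) (e : nat -> N) :
  finite_set (range e) -> finite_set (range (env_app s e)).
Proof.
move=> fin_e; apply: (@sub_finite_set _ _ ((env_app s e @` `I_(size s)) `|` range e)).
  move=> _ [i _ <-]; case: (ltnP i (size s)) => h; first by left; exists i.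
  by right; exists (i - size s)%N => //; rewrite /env_app ltnNge h.
by rewrite finite_setU; split=> //; apply: finite_image; apply: finite_II.
Qed.

(** The formulas [F k] say that both halves cut out by [b] carry trees of height [k]. Finitely many
    of them are realized by the root of one tall tree, so saturation gives one index [b] that serves
    all heights. *)
Lemma big_split X : big X ->
  exists b : n.-tuple N, big (X `&` instances phi q b) /\ big (X `\` instances phi q b).
Proof.
move=> [[d [e [Y [eq_eq fin_e XE]]]] treeX].
pose Y1 := And (weaken m n Y) (shift_params m n phi d).
pose Y2 := And (weaken m n Y) (Not (shift_params m n phi d)).
have eq' (b : n.-tuple N) i : env_app b e (d.+1 * n + i)%N = q i.
  by rewrite /env_app size_tuple mulSn -addnA ltnNge leq_addr /= addKn.
have E1 (b : n.-tuple N) : @slice L m _ (env_app b e) Y1 = X `&` instances phi q b.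
  apply/seteqP; split=> t; rewrite XE /slice /mkset sat_and sat_weaken
    (sat_shift_params _ _ _ eq_eq) //.
have E2 (b : n.-tuple N) : @slice L m _ (env_app b e) Y2 = X `\` instances phi q b.
  apply/seteqP; split=> t; rewrite XE /slice /mkset sat_and sat_weaken
    sat_not (sat_shift_params _ _ _ eq_eq) //.
pose F k := And (tree_formula m n phi d.+1 k Y1) (tree_formula m n phi d.+1 k Y2).
have satF (b : n.-tuple N) k : solutions (F k) (fun i => e (i - n)%N) b <->
    tree (@instances L m n phi N q) k (X `&` instances phi q b) /\
    tree (@instances L m n phi N q) k (X `\` instances phi q b).
  rewrite /solutions /mkset.
  have -> : (fun i => nth (e (i - n)%N) b i) = env_app b e.
    apply/funext => i; rewrite /env_app size_tuple; case: ltnP => h.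
      by apply: set_nth_default; rewrite size_tuple.
    by rewrite nth_default // size_tuple.
  by rewrite sat_and !(sat_tree_formula _ _ _ _ (eq' b)) E1 E2.
have [|Delta finD subD|b Hb] := N_sat (Gamma := range F) (n := n)
    (e := fun i => e (i - n)%N).
- by apply: sub_finite_set fin_e => _ [i _ <-]; exists (i - n)%N.
- have [K HK] := finite_sub_range finD subD.
  have [b Hb] := treeX K.+1; exists b => _ /HK[k /= kK <-].
  by apply/satF; split; apply: (tree_le kK); case: Hb.
have Hb' k : tree (@instances L m n phi N q) k (X `&` instances phi q b) /\
             tree (@instances L m n phi N q) k (X `\` instances phi q b).
  by apply/satF/Hb; exists k.
exists b; split; (split=> [|k]; last by case: (Hb' k)).
  by exists d.+1, (env_app b e), Y1; split; rewrite ?E1 //; exact: range_env_app.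
by exists d.+1, (env_app b e), Y2; split; rewrite ?E2 //; exact: range_env_app.
Qed.

Lemma big_definable X : big X -> definable X.
Proof.
move=> [[d [e [Y [_ _ ->]]]] _]; exists Y, (fun i => e (i - m)%N).
apply/seteqP; split=> t; rewrite /slice /solutions /mkset;
have -> : (fun i => nth (e (i - m)%N) t i) = env_app t e => //.
all: apply/funext => i; rewrite /env_app size_tuple; case: ltnP => h;
  [by apply: set_nth_default; rewrite size_tuple
  |by rewrite nth_default // size_tuple].
Qed.

(** Splitting the remainder again and again cuts off a sequence of disjoint pieces, each of which is
    still big. *)
Lemma big_rank k X : big X -> rank_ge_in k X.
Proof.
elim: k X => [|k IH] X bigX; first by have [_ /(_ 0%N)] := bigX.
have H (Z : set (m.-tuple N)) : exists b : n.-tuple N, big Z ->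
    big (Z `&` instances phi q b) /\ big (Z `\` instances phi q b).
  have [/big_split[b]|] := pselect (big Z); first by exists b.
  (* For [Z] not big any index is a valid default, and one exists because [X] carries a tree of
     height 1. *)
  by have [[b _]|nb nZ] := pselect (exists b : n.-tuple N, True);
    [exists b|case: (bigX) => _ /(_ 1%N)[b]; exists b].
have [b Hb] := choice H.
pose Z i := iter i (fun A => A `\` instances phi q (b A)) X.
have bigZ i : big (Z i) by elim: i => //= i /Hb[].
have Zle i j : (i <= j)%N -> Z j `<=` Z i.
  by move=> /subnK <-; elim: (j - i)%N => //= d IHd t [/IHd].
exists (fun i => Z i `&` instances phi q (b (Z i))); split=> [i||i|i].
- by apply: big_definable; case: (Hb _ (bigZ i)).
- have disj i j t : (i < j)%N -> instances phi q (b (Z i)) t -> ~ Z j t.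
    by move=> lt_ij ht /(Zle _ _ lt_ij)[].
  move=> i j _ _ [t [[h1 h2] [h3 h4]]]; apply/eqP.
  by case: ltngtP => // h; [case: (disj _ _ t h)|case: (disj _ _ t h)].
- by move=> t [/(Zle 0%N i isT)].
- by apply: IH; case: (Hb _ (bigZ i)).
Qed.

End NoLadder.

(** A ladder in [M] gives trees of every finite height there. Each height is a first-order
    statement, so it passes to [N], where all heights together contradict the bound on the rank. *)
Theorem no_ladder (L : language) (M N : structure L) (f : M -> N)
    (f_el : elementary_embedding f) (N_sat : aleph0_saturated N)
    (m n r : nat) (phi : formula L) (e : nat -> M)
    (rk : ~ rank_ge_in r (@solutions L N m phi (f \o e)))
    (D : set ((m + n).-tuple M)) (D_def : definable D)
    (t : nat -> m.-tuple M) (b : nat -> n.-tuple M) :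
  (forall i, solutions phi e (t i)) ->
  ~ forall i j, D (cat_tuple (t i) (b j)) <-> (i <= j)%N.
Proof.
move=> Xt Dtb; have [psi [p DE]] := D_def.
(* Both formulas are renamed so as to read their parameters from the single environment
   [mix e p]. *)
pose psi' := rename (fun i => if (i < m + n)%N then i else (m + n + i.*2.+1)%N) psi.
pose phi' := rename (fun i => if (i < m)%N then i else (m + i.*2)%N) phi.
have [B1 H1] := sat_bound psi'; have [B2 H2] := sat_bound phi'.
(* Beyond the bounds neither formula looks at its environment; making it constant there leaves
   finitely many parameters. *)
pose q i := mix e p (if (i < maxn B1 B2)%N then i else 0%N).
have slE (S : structure L) (g : M -> S) : @slice L m _ (g \o q) phi' = solutions phi (g \o e).
  rewrite /slice /solutions.
  have E (u : m.-tuple S) : sat (env_app u (g \o q)) phi' <->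
      sat (fun i => nth ((g \o e) i) u i) phi.
    rewrite (H2 _ _ (env_app u (g \o mix e p))); last first.
      move=> i iB; rewrite /env_app /= size_tuple; case: ltnP => h.
        by apply: set_nth_default; rewrite size_tuple.
      by rewrite /q leq_max (leq_ltn_trans (leq_subr _ _) iB) orbT.
    rewrite sat_rename comp_mix.
    suff -> : env_app u (mix (g \o e) (g \o p)) \o
      (fun i => if (i < m)%N then i else (m + i.*2)%N) =
      fun i => nth ((g \o e) i) u i by [].
    apply/funext => i; rewrite /env_app /= size_tuple; case: (ltnP i m) => h.
      by rewrite h; apply: set_nth_default; rewrite size_tuple.
    by rewrite ltnNge leq_addr /= addKn mixD nth_default // size_tuple.
  by apply/seteqP; split=> u /E.
have inE (u : m.-tuple M) (v : n.-tuple M) : instances psi' q v u <-> D (cat_tuple u v).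
  rewrite DE /instances /solutions /mkset.
  rewrite (H1 _ _ (env_app u (env_app v (mix e p)))); last first.
    move=> i iB; rewrite /env_app /= !size_tuple; case: ltnP => h.
      by apply: set_nth_default; rewrite size_tuple.
    case: ltnP => h'; first by apply: set_nth_default; rewrite size_tuple.
    by rewrite /q leq_max (leq_ltn_trans _ iB) // -subnDA leq_subr.
  rewrite /psi' sat_rename.
  suff -> : env_app u (env_app v (mix e p)) \o
      (fun i => if (i < m + n)%N then i else (m + n + i.*2.+1)%N) =
      fun i => nth (p i) (cat_tuple u v) i by [].
  apply/funext => i; rewrite /env_app /= !size_tuple nth_cat size_tuple.
  case: (ltnP i (m + n)) => h.
    case: ltnP => h'; first by apply: set_nth_default; rewrite size_tuple.
    by rewrite ltn_subLR // h; apply: set_nth_default; rewrite size_tuple ltn_subLR.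
  have mi : (m <= i)%N by apply: leq_trans h; apply: leq_addr.
  rewrite -addnA ltnNge leq_addr /= addKn ltnNge leq_addr /= addKn mixDS.
  rewrite [(i < m)%N]ltnNge mi /= nth_default // size_tuple -(leq_add2r m).
  by rewrite subnK // addnC.
have treeM k : tree (@instances L m n psi' _ q) k (@slice L m _ q phi').
  apply: (@ladder_tree _ _ _ _ t b 0) => [i _|i j]; last by rewrite inE Dtb.
  by have := slE M id; rewrite /comp => ->.
apply: rk; apply: (@big_rank L m n psi' N N_sat (f \o q)).
split.
  exists 0%N, (f \o q), phi'; split=> //.
  apply: (@sub_finite_set _ _ ((f \o mix e p) @` `I_(maxn B1 B2).+1)).
    move=> _ [i _ <-]; rewrite /q /=; case: ltnP => h; last by exists 0%N.
    by exists i => //=; apply: leqW.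
  by apply: finite_image; apply: finite_II.
move=> k; rewrite -(slE N f).
apply/(@sat_tree_formula _ _ _ _ _ (f \o q) _ 0); first by [].
by apply/f_el/(@sat_tree_formula _ _ _ _ _ q q 0).
Qed.

(** * A calculus of definable sets and functions *)

Section EnvDefinability.
Variables (L : language) (M : structure L).
Implicit Types (e p : nat -> M) (Q : (nat -> M) -> Prop).

(** Conditions on whole environments avoid counting variables; tuples enter as blocks of consecutive
    positions, through [read]. *)
Definition env_definable Q : Prop :=
  exists phi p, forall e, Q e <-> sat (mix e p) phi.

Lemma env_definable_ext Q Q' :
  (forall e, Q e <-> Q' e) -> env_definable Q -> env_definable Q'.
Proof. by move=> QQ' [phi [p H]]; exists phi, p => e; rewrite -QQ' H. Qed.

Lemma env_definable_not Q : env_definable Q -> env_definable (fun e => ~ Q e).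
Proof.
by move=> [phi [p H]]; exists (Not phi), p => e; rewrite H sat_not.
Qed.

Lemma env_definable_and Q Q' : env_definable Q -> env_definable Q' ->
  env_definable (fun e => Q e /\ Q' e).
Proof.
move=> [phi [p H]] [psi [q H']].
pose s b i := if odd i then (i./2.*2 + b).*2.+1 else i.
exists (And (rename (s 0%N) phi) (rename (s 1%N) psi)), (mix p q) => e.
rewrite sat_and !sat_rename H H'.
have -> : mix e (mix p q) \o s 0%N = mix e p.
  apply/funext => i; rewrite /= /s; elim/nat_parity_ind: i => i.
    by rewrite odd_double !mixD.
  by rewrite oddS odd_double /= uphalf_double addn0 !mixDS mixD.
have -> // : mix e (mix p q) \o s 1%N = mix e q.
apply/funext => i; rewrite /= /s; elim/nat_parity_ind: i => i.
  by rewrite odd_double !mixD.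
by rewrite oddS odd_double /= uphalf_double addn1 !mixDS.
Qed.

Lemma env_definable_rename (s : nat -> nat) Q :
  env_definable Q -> env_definable (fun e => Q (e \o s)).
Proof.
move=> [phi [p H]].
exists (rename (fun i => if odd i then i else (s i./2).*2) phi), p => e.
rewrite sat_rename H; have -> // : mix (e \o s) p =
  mix e p \o (fun i => if odd i then i else (s i./2).*2).
apply/funext; elim/nat_parity_ind => i /=.
  by rewrite odd_double doubleK !mixD.
by rewrite odd_double /= !mixDS.
Qed.

Definition upd (k : nat) (x : M) e (i : nat) : M := if i == k then x else e i.

Lemma env_definable_ex k Q :
  env_definable Q -> env_definable (fun e => exists x, Q (upd k x e)).
Proof.
move=> [phi [p H]].
pose s i := if i == k.*2 then 0%N else i.+1.
exists (Ex (rename s phi)), p => e; rewrite sat_ex.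
have E x : env_cons x (mix e p) \o s = mix (upd k x e) p.
  apply/funext; elim/nat_parity_ind => i; rewrite /s /=.
    rewrite mixD /upd; have -> : (i.*2 == k.*2) = (i == k).
      by rewrite -!muln2 eqn_pmul2r.
    by case: eqP => //=; rewrite mixD.
  rewrite mixDS; case: eqP => [E|/=]; last by rewrite mixDS.
  by have := congr1 odd E; rewrite /= !odd_double.
by split=> -[x h]; exists x; move: h; rewrite sat_rename E H.
Qed.

(** The carrier may be empty, in which case there is no parameter environment at all. The conjunct
    [Q] supplies one; [env_definable_and_forall] is phrased through conjunctions for the same
    reason. *)
Lemma env_definable_and_eq Q i j : env_definable Q ->
  env_definable (fun e => Q e /\ e i = e j).
Proof.
move=> Qdef; have [phi [p _]] := Qdef; apply: env_definable_and => //.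
by exists (Eq (Var L i.*2) (Var L j.*2)), p => e /=; rewrite !mixD.
Qed.

Lemma env_definable_val i (x : M) : env_definable (fun e => e i = x).
Proof.
by exists (Eq (Var L i.*2) (Var L 1)), (fun=> x) => e /=; rewrite mixD.
Qed.

Lemma env_definable_and_forall n (Q0 : (nat -> M) -> Prop)
    (Q : 'I_n -> (nat -> M) -> Prop) :
  env_definable Q0 -> (forall Q', env_definable Q' ->
    forall i, env_definable (fun e => Q' e /\ Q i e)) ->
  env_definable (fun e => Q0 e /\ forall i, Q i e).
Proof.
elim: n Q => [|n IH] Q Q0def Qdef.
  by apply: env_definable_ext Q0def => e; split=> [h|[]//]; split=> // -[].
have := Qdef _ (IH _ Q0def (fun _ Q'def i => Qdef _ Q'def (lift ord0 i))) ord0.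
apply: env_definable_ext => e; split=> [[[h0 h] h1]|[h0 h]]; last by split.
by split=> // i; case: (unliftP ord0 i) => [j ->|->].
Qed.

Lemma env_definable_ex_block k n Q : env_definable Q ->
  env_definable (fun e => exists e', (forall i, (i < k)%N || (k + n <= i)%N ->
    e' i = e i) /\ Q e').
Proof.
elim: n Q => [|n IH] Q Qdef.
  apply: env_definable_ext Qdef => e; split=> [h|[e' [ee']]].
    by exists e.
  suff -> : e' = e by [].
  by apply/funext => i; apply: ee'; rewrite addn0; case: ltnP.
have := IH _ (env_definable_ex (k + n) Qdef).
apply: env_definable_ext => e; split=> [[e' [ee' [x h]]]|[e' [ee' h]]].
  exists (upd (k + n) x e'); split=> // i hi; rewrite /upd.
  case: eqP hi => [->|/eqP nkn]; first by rewrite ltnNge leq_addr addnS ltnn.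
  move=> hi; apply: ee'; case/orP: hi => [->//|].
  by rewrite addnS => /ltnW ->; rewrite orbT.
exists (upd (k + n) (e (k + n)%N) e'); split.
  move=> i hi; rewrite /upd; case: eqP => [->//|/eqP nkn]; apply: ee'.
  case/orP: hi => [->//|]; rewrite leq_eqVlt eq_sym (negPf nkn) /=.
  by rewrite addnS => ->; rewrite orbT.
exists (e' (k + n)%N); suff -> : upd (k + n) (e' (k + n)%N)
  (upd (k + n) (e (k + n)%N) e') = e' by [].
by apply/funext => i; rewrite /upd; case: eqP => // ->.
Qed.

Definition read n k e : n.-tuple M := mktuple (fun i : 'I_n => e (k + i)%N).

Lemma read_comp n k s e l :
  (forall i, (i < n)%N -> s (k + i)%N = (l + i)%N) ->
  read n k (e \o s) = read n l e.
Proof.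
by move=> E; apply: eq_from_tnth => i; rewrite !tnth_mktuple /= E.
Qed.

Lemma eq_read n k e e' :
  (forall i, (k <= i < k + n)%N -> e i = e' i) -> read n k e = read n k e'.
Proof.
move=> E; apply: eq_from_tnth => i; rewrite !tnth_mktuple E //.
by rewrite leq_addr ltn_add2l /=.
Qed.

Lemma read_inj n k l e : read n k e = read n l e <->
  forall i : 'I_n, e (k + i)%N = e (l + i)%N.
Proof.
split=> [E i|E]; last by apply: eq_from_tnth => i; rewrite !tnth_mktuple.
by have := congr1 (fun t => tnth t i) E; rewrite !tnth_mktuple.
Qed.

Lemma exists_read n k e (t : n.-tuple M) : exists e',
  (forall i, (i < k)%N || (k + n <= i)%N -> e' i = e i) /\ read n k e' = t.
Proof.
exists (fun i => if (k <= i < k + n)%N then nth (e i) t (i - k)%N else e i).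
split=> [i|].
  case/orP => h; first by rewrite leqNgt h.
  by rewrite [(i < _)%N]ltnNge h andbF.
apply: eq_from_tnth => i; rewrite tnth_mktuple leq_addr ltn_add2l ltn_ord /=.
by rewrite addKn (tnth_nth (e (k + i)%N)).
Qed.

Lemma cat_tuple_read m n k e (s : m.-tuple M) (t : n.-tuple M) :
  cat_tuple s t = read (m + n) k e <-> s = read m k e /\ t = read n (k + m) e.
Proof.
have E : cat_tuple (read m k e) (read n (k + m) e) = read (m + n) k e.
  apply: eq_from_tnth => i; rewrite tnth_mktuple (tnth_nth (e 0%N)) /= nth_cat.
  rewrite size_map size_enum_ord; case: ltnP => im.
    by rewrite (nth_map (Ordinal im)) ?size_enum_ord // nth_enum_ord.
  have h : (i - m < n)%N by rewrite ltn_subLR.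
  rewrite (nth_map (Ordinal h)) ?size_enum_ord // nth_enum_ord //.
  by rewrite -addnA subnKC.
split=> [|[-> ->]]; last exact: E.
rewrite -E => /(congr1 (@tval _ _)) E'.
split; apply: val_inj => /=.
  move: (congr1 (take m) E'); rewrite (take_size_cat _ (size_tuple s)).
  by rewrite (take_size_cat _ (size_tuple (read m k e))).
move: (congr1 (drop m) E'); rewrite (drop_size_cat _ (size_tuple s)).
by rewrite (drop_size_cat _ (size_tuple (read m k e))).
Qed.

Lemma definableP n (X : set (n.-tuple M)) :
  definable X <-> env_definable (fun e => X (read n 0 e)).
Proof.
split=> [[phi [p ->]]|[phi [p H]]].
  exists (rename (fun i => if (i < n)%N then i.*2 else i.*2.+1) phi), p => e.
  rewrite sat_rename /solutions /mkset.
  have -> // : mix e p \o (fun i => if (i < n)%N then i.*2 else i.*2.+1) =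
    fun i => nth (p i) (read n 0 e) i.
  apply/funext => i; rewrite /comp; case: ltnP => h; last first.
    by rewrite mixDS nth_default // size_tuple.
  by rewrite mixD -(tnth_nth (p i) (read n 0 e) (Ordinal h)) tnth_mktuple.
(* Only the variables below [n] matter to [X], so every later variable is sent to the single
   position [n], which holds the parameter [p 0]. *)
pose s i := if odd i then (n + i./2)%N else if (i./2 < n)%N then i./2 else n.
exists (rename s phi), (fun i => p (i - n)%N).
apply/seteqP; split=> t; rewrite /solutions /mkset sat_rename.
all: set e := fun i => nth (p (i - n)%N) t i.
all: have -> : e \o s = mix (fun i => if (i < n)%N then e i else e n) p.
all: try (apply/funext; elim/nat_parity_ind => i; rewrite /s /=;
  [rewrite mixD odd_double doubleK; case: ltnP => //
  |rewrite mixDS odd_double /= uphalf_double /e nth_default ?size_tuple ?leq_addr // addKn //]).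
all: rewrite -H; have -> // : read n 0 (fun i => if (i < n)%N then e i else e n) = t.
all: apply: eq_from_tnth => i; rewrite tnth_mktuple add0n ltn_ord /e.
all: by rewrite (tnth_nth (p (i - n)%N)).
Qed.

End EnvDefinability.

(** * Definable sets and functions on types with coordinates *)

Section Coordinates.
Variables (L : language) (M : structure L).

Definition dset T (c : coordinates M T) (P : T -> Prop) : Prop :=
  definable_in c P.

Lemma dsetP T (c : coordinates M T) (P : T -> Prop) k :
  dset c P -> env_definable (fun e => exists2 t, P t & c t = read _ k e).
Proof.
move=> /definableP /(env_definable_rename (fun i => (k + i)%N)).
apply: env_definable_ext => e; rewrite (@read_comp _ _ _ _ _ _ k) //.
Qed.

Lemma dsetE T (c : coordinates M T) (P : T -> Prop) :
  env_definable (fun e => exists2 t, P t & c t = read _ 0 e) -> dset c P.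
Proof. by move=> H; apply/definableP. Qed.

Lemma dset_ext T (c : coordinates M T) (P Q : T -> Prop) :
  (forall t, P t <-> Q t) -> dset c P -> dset c Q.
Proof. by move=> E; rewrite (_ : P = Q) //; apply/funext => t; apply/propext. Qed.

Lemma dset_pairP S T (c : coordinates M S) (d : coordinates M T)
    (P : S * T -> Prop) k l :
  dset (coord_pair c d) P ->
  env_definable (fun e => exists s t, [/\ P (s, t), c s = read _ k e
                                        & d t = read _ l e]).
Proof.
move=> /definableP /(env_definable_rename
  (fun i => if (i < coord_dim c)%N then (k + i)%N else (l + (i - coord_dim c))%N)).
apply: env_definable_ext => e.
have E s t : coord_pair_fun c d (s, t) = read _ 0 (e \o (fun i =>
    if (i < coord_dim c)%N then (k + i)%N else (l + (i - coord_dim c))%N)) <->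
  c s = read _ k e /\ d t = read _ l e.
  rewrite /coord_pair_fun cat_tuple_read (@read_comp _ _ _ _ _ _ k); last first.
    by move=> i; rewrite add0n => ->.
  rewrite (@read_comp _ _ _ _ _ _ l) // => i _.
  by rewrite add0n ltnNge leq_addr /= addKn.
split=> [[[s t] h /E[]]|[s [t [h1 h2 h3]]]]; first by exists s, t.
by exists (s, t) => //; apply/E.
Qed.

Lemma dset_pairE S T (c : coordinates M S) (d : coordinates M T)
    (P : S * T -> Prop) :
  env_definable (fun e => exists s t, [/\ P (s, t), c s = read _ 0 e
    & d t = read _ (coord_dim c) e]) ->
  dset (coord_pair c d) P.
Proof.
move=> H; apply: dsetE; apply: env_definable_ext H => e.
split=> [[s [t [h1 h2 h3]]]|[[s t] h /cat_tuple_read[h1 h2]]].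
  by exists (s, t) => //; apply/cat_tuple_read.
by exists s, t.
Qed.

Definition dfun S T (c : coordinates M S) (d : coordinates M T) (f : S -> T) :=
  dset (coord_pair c d) (fun u => f u.1 = u.2).

Definition dtype T (c : coordinates M T) := dset c (fun=> True).

Section Boolean.
Variables (S : Type) (c : coordinates M S).

Lemma dset_and P Q : dset c P -> dset c Q -> dset c (fun x => P x /\ Q x).
Proof.
move=> /(dsetP 0) HP /(dsetP 0) HQ; apply: dsetE.
apply: env_definable_ext (env_definable_and HP HQ) => e.
split=> [[[x Px cx] [y Qy cy]]|[x [Px Qx] cx]]; last by split; exists x.
by exists x => //; split=> //; rewrite (@coord_inj _ _ _ c x y) // cx.
Qed.

Lemma dset_not P : dtype c -> dset c P -> dset c (fun x => ~ P x).
Proof.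
move=> /(dsetP 0) HT /(dsetP 0) HP; apply: dsetE.
apply: env_definable_ext (env_definable_and HT (env_definable_not HP)) => e.
split=> [[[x _ cx] nP]|[x nPx cx]].
  by exists x => // Px; apply: nP; exists x.
split; first by exists x.
by move=> [y Py cy]; apply: nPx; rewrite (@coord_inj _ _ _ c x y) // cx.
Qed.

Lemma dset_or P Q : dtype c -> dset c P -> dset c Q -> dset c (fun x => P x \/ Q x).
Proof.
move=> Hc HP HQ.
have := dset_not Hc (dset_and (dset_not Hc HP) (dset_not Hc HQ)).
apply: dset_ext => x; split=> [H|[]h [] //].
by apply: contrapT => H'; apply: H; split=> h; apply: H'; [left|right].
Qed.

Lemma dset_imp P Q : dtype c -> dset c P -> dset c Q -> dset c (fun x => P x -> Q x).
Proof.
move=> Hc HP HQ; have := dset_or Hc (dset_not Hc HP) HQ.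
apply: dset_ext => x; split=> [[nP /nP//|//]|H].
by have [/H|] := pselect (P x); [right|left].
Qed.

End Boolean.

Section Functions.
Variables (S T U : Type) (c : coordinates M S) (d : coordinates M T)
  (u : coordinates M U).

Lemma dset_ex (P : S -> T -> Prop) :
  dset (coord_pair c d) (fun x => P x.1 x.2) -> dset c (fun x => exists y, P x y).
Proof.
move=> /(dset_pairP 0 (coord_dim c)).
move=> /(env_definable_ex_block (coord_dim c) (coord_dim d)) H; apply: dsetE.
apply: env_definable_ext H => e; split.
  move=> [e' [ee' [x [y [h1 h2 _]]]]]; exists x; first by exists y.
  by rewrite h2; apply: eq_read => i /= hi; apply: ee'; rewrite -[coord_dim c]add0n hi.
move=> [x [y Pxy] cx]; have [e' [ee' h]] := exists_read (coord_dim c) e (d y).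
exists e'; split=> //; exists x, y; split=> //.
by rewrite cx; apply: eq_read => i /= hi; rewrite ee' // -[coord_dim c]add0n hi.
Qed.

Lemma dtype_pair : dtype c -> dtype d -> dtype (coord_pair c d).
Proof.
move=> /(dsetP 0) Hc /(dsetP (coord_dim c)) Hd; apply: dset_pairE.
apply: env_definable_ext (env_definable_and Hc Hd) => e.
split=> [[[x _ cx] [y _ cy]]|[x [y [_ cx cy]]]]; first by exists x, y.
by split; [exists x|exists y].
Qed.

Lemma dset_all (P : S -> T -> Prop) : dtype c -> dtype d ->
  dset (coord_pair c d) (fun x => P x.1 x.2) -> dset c (fun x => forall y, P x y).
Proof.
move=> Hc Hd HP; have := dset_not Hc (dset_ex (P:=fun x y => ~ P x y)
  (dset_not (dtype_pair Hc Hd) HP)).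
apply: dset_ext => x; split=> [H y|H [y]]; last exact.
by apply: contrapT => H'; apply: H; exists y.
Qed.

Lemma dfunP (f : S -> T) k l : dfun c d f ->
  env_definable (fun e => exists2 x, c x = read _ k e & d (f x) = read _ l e).
Proof.
move=> /(dset_pairP k l); apply: env_definable_ext => e.
by split=> [[x [y /= [<- ? ?]]]|[x ? ?]]; [exists x|exists x, (f x)].
Qed.

Lemma dfunE (f : S -> T) :
  env_definable (fun e => exists2 x, c x = read _ 0 e
                                   & d (f x) = read _ (coord_dim c) e) ->
  dfun c d f.
Proof.
move=> H; apply: dset_pairE; apply: env_definable_ext H => e.
by split=> [[x ? ?]|[x [y /= [<- ? ?]]]]; [exists x, (f x)|exists x].
Qed.

End Functions.

Section Basics.
Variables (S T : Type) (c : coordinates M S) (d : coordinates M T).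

Lemma dfun_id : dtype c -> dfun c c (fun x => x).
Proof.
move=> /(dsetP 0) Hc; apply: dfunE.
have := env_definable_and_forall (Q := fun (i : 'I_(coord_dim c)) e =>
  e (0 + i)%N = e (coord_dim c + i)%N) Hc
  (fun Q' Q'def i => env_definable_and_eq _ _ Q'def).
apply: env_definable_ext => e; rewrite -read_inj.
split=> [[[x _ cx] E]|[x cx cx']]; first by exists x; rewrite // -E.
by split; [exists x|rewrite -cx].
Qed.

Lemma dfun_const (y : T) : dtype c -> dfun c d (fun=> y).
Proof.
move=> /(dsetP 0) Hc; apply: dfunE.
have := env_definable_and_forall (Q := fun (i : 'I_(coord_dim d)) e =>
  e (coord_dim c + i)%N = tnth (d y) i) Hc
  (fun Q' Q'def i => env_definable_and Q'def (env_definable_val _ _)).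
apply: env_definable_ext => e; split=> [[[x _ cx] E]|[x cx E]].
  by exists x => //; apply: eq_from_tnth => i; rewrite tnth_mktuple E.
by split; [exists x|move=> i; rewrite E tnth_mktuple].
Qed.

End Basics.

Section Combinators.
Variables (S T U : Type) (c : coordinates M S) (d : coordinates M T)
  (u : coordinates M U).

Lemma dset_preim (f : S -> T) (P : T -> Prop) :
  dset d P -> dfun c d f -> dset c (fun x => P (f x)).
Proof.
move=> HP Hf; apply: (dset_ext (P := fun x => exists y, f x = y /\ P y)).
  by move=> x; split=> [[y [<-]]|h]; last exists (f x).
apply: (dset_ex (d := d)); apply: dset_pairE.
have := env_definable_and (dfunP 0 (coord_dim c) Hf) (dsetP (coord_dim c) HP).
apply: env_definable_ext => e; split=> [[[x cx df] [y Py dy]]|].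
  exists x, y; split=> //=; split=> //; apply: (@coord_inj _ _ _ d).
  by rewrite df dy.
by move=> [x [y /= [[<- Py] cx dy]]]; split; [exists x|exists (f x)].
Qed.

Lemma dset_eq (f g : S -> T) :
  dfun c d f -> dfun c d g -> dset c (fun x => f x = g x).
Proof.
move=> Hf Hg; apply: (dset_ext (P := fun x => exists y, f x = y /\ g x = y)).
  by move=> x; split=> [[y [<-]]|h]; last exists (f x).
by apply: (dset_ex (d := d)); apply: dset_and.
Qed.

Lemma dfun_comp (f : S -> T) (g : T -> U) :
  dfun d u g -> dfun c d f -> dfun c u (fun x => g (f x)).
Proof.
move=> Hg Hf; apply: dfunE.
set n := (coord_dim c + coord_dim u)%N.
have := env_definable_ex_block n (coord_dim d)
  (env_definable_and (dfunP 0 n Hf) (dfunP n (coord_dim c) Hg)).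
apply: env_definable_ext => e; split.
  move=> [e' [ee' [[x cx df] [y dy ug]]]]; exists x.
    rewrite cx; apply: eq_read => i /= hi; apply: ee'.
    by rewrite (leq_trans hi) // leq_addr.
  have -> : f x = y by apply: (@coord_inj _ _ _ d); rewrite df dy.
  by rewrite ug; apply: eq_read => i /andP[_ hi]; apply: ee'; rewrite hi.
move=> [x cx ug]; have [e' [ee' h]] := exists_read n e (d (f x)).
exists e'; split=> //; split; [exists x|exists (f x)] => //.
  rewrite cx; apply: eq_read => i /= hi; rewrite ee' //.
  by rewrite (leq_trans hi) // leq_addr.
by rewrite ug; apply: eq_read => i /andP[_ hi]; rewrite ee' // hi.
Qed.

Lemma dfun_pair (f : S -> T) (g : S -> U) :
  dfun c d f -> dfun c u g -> dfun c (coord_pair d u) (fun x => (f x, g x)).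
Proof.
move=> Hf Hg; apply: dfunE => /=.
have := env_definable_and (dfunP 0 (coord_dim c) Hf)
  (dfunP 0 (coord_dim c + coord_dim d) Hg).
apply: env_definable_ext => e; split=> [[[x cx df] [y cy ug]]|].
  have E : x = y by apply: (@coord_inj _ _ _ c); rewrite cx cy.
  by exists x => //; apply/cat_tuple_read; rewrite /= {2}E.
by move=> [x cx /cat_tuple_read[h1 h2]]; split; exists x.
Qed.

Lemma dfun_fst (f : S -> T * U) :
  dfun c (coord_pair d u) f -> dfun c d (fun x => (f x).1).
Proof.
move=> Hf; apply: (dset_ext (P := fun x : S * T => exists y : U, f x.1 = (x.2, y))).
  move=> [x y]; split=> [[z /= ->]//|/= <-]; exists (f x).2; exact: surjective_pairing.
apply: (dset_ex (d := u)); apply: dset_pairE.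
have := dfunP 0 (coord_dim c) Hf; apply: env_definable_ext => e.
split=> [[x cx /cat_tuple_read[h1 h2]]|].
  exists (x, (f x).1), (f x).2; split=> //; first exact: surjective_pairing.
  by apply/cat_tuple_read.
move=> [[x y] [z [/= E /cat_tuple_read[/= h1 h2] h3]]]; exists x => //.
by apply/cat_tuple_read; rewrite E.
Qed.

Lemma dfun_snd (f : S -> T * U) :
  dfun c (coord_pair d u) f -> dfun c u (fun x => (f x).2).
Proof.
move=> Hf; apply: (dset_ext (P := fun x : S * U => exists y : T, f x.1 = (y, x.2))).
  move=> [x y]; split=> [[z /= ->]//|/= <-]; exists (f x).1; exact: surjective_pairing.
apply: (dset_ex (d := d)); apply: dset_pairE.
(* The blocks of the two components are exchanged, because the quantified first component has to
   come last. *)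
pose s i := if (i < coord_dim c)%N then i
  else if (i < coord_dim c + coord_dim d)%N then (i + coord_dim u)%N
  else (i - coord_dim d)%N.
have := env_definable_rename s (dfunP 0 (coord_dim c) Hf).
have Ec e : read (coord_dim c) 0 (e \o s) = read (coord_dim c) 0 e.
  by apply: read_comp => i h; rewrite /s add0n h.
have Ed e : read (coord_dim d) (coord_dim c) (e \o s) =
            read (coord_dim d) (coord_dim c + coord_dim u) e.
  apply: read_comp => i h.
  by rewrite /s ltnNge leq_addr /= ltn_add2l h addnAC.
have Eu e : read (coord_dim u) (coord_dim c + coord_dim d) (e \o s) =
            read (coord_dim u) (coord_dim c) e.
  apply: read_comp => i h; rewrite /s -addnA ltnNge leq_addr /= ltn_add2l.
  by rewrite ltnNge leq_addr /= addnCA addKn.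
apply: env_definable_ext => e.
split=> [[x cx /cat_tuple_read[h1 h2]]|].
  exists (x, (f x).2), (f x).1; split=> /=; first exact: surjective_pairing.
    by apply/cat_tuple_read; rewrite /= add0n -Ec -Eu.
  by rewrite -Ed.
move=> [[x y] [z [/= E /cat_tuple_read[/= h1 h2] h3]]]; exists x.
  by rewrite Ec.
by apply/cat_tuple_read; rewrite E /= Ed Eu.
Qed.

End Combinators.

Lemma dfun_app2 R S T U (a : coordinates M R) (c : coordinates M S)
    (d : coordinates M T) (u : coordinates M U) (h : S -> T -> U) f g :
  definable_fun2 c d u h ->
  dfun a c f -> dfun a d g -> dfun a u (fun x => h (f x) (g x)).
Proof. by move=> Hh Hf Hg; apply: dfun_comp Hh (dfun_pair Hf Hg). Qed.

Lemma dset_image S T (c : coordinates M S) (d : coordinates M T) (f : S -> T)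
    (P : S -> Prop) :
  dtype c -> dtype d -> dfun c d f -> dset c P -> dset d (f @` P).
Proof.
move=> Hc Hd Hf HP.
apply: (dset_ext (P := fun y => exists x, P x /\ f x = y)).
  by move=> y; split=> [[x [h <-]]|[x h <-]]; exists x.
apply: (dset_ex (d := c)); apply: dset_and.
  apply: (dset_preim (d := c)) => //; apply: (dfun_snd (d := d)).
  by apply: dfun_id; apply: dtype_pair.
apply: dset_eq; last by apply: (dfun_fst (u := c)); apply/dfun_id/dtype_pair.
apply: (dfun_comp Hf); apply: (dfun_snd (d := d)).
by apply: dfun_id; apply: dtype_pair.
Qed.

End Coordinates.

Arguments read : simpl never.

(** Follows the syntax of a predicate: connectives and quantifiers go to the closure lemmas,
    functions and predicates to hypotheses in the context. This is why facts such as [dfun_opp] are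
    put into the context beforehand. *)
Ltac dset_tac :=
  cbn beta;
  lazymatch goal with
  | |- dtype _ => first [assumption | apply: dtype_pair; dset_tac]
  | |- dfun ?c ?d (@fst ?A ?B) => change (dfun c d (fun u : A * B => fst u)); dset_tac
  | |- dfun ?c ?d (@snd ?A ?B) => change (dfun c d (fun u : A * B => snd u)); dset_tac
  | |- dfun _ _ (fun u => u) => apply: dfun_id; dset_tac
  | |- dfun _ _ (fun _ => ?x) => apply: dfun_const; dset_tac
  | |- dfun _ _ (fun u => fst _) => eapply dfun_fst; dset_tac
  | |- dfun _ _ (fun u => snd _) => eapply dfun_snd; dset_tac
  | |- dfun _ _ (fun u => (_, _)) => eapply dfun_pair; dset_tac
  | |- dfun _ _ _ => first [assumption |
      match goal with
      | H : definable_fun2 _ _ _ _ |- _ => eapply (dfun_app2 H); dset_tac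
      | H : dfun _ _ _ |- _ => eapply (dfun_comp H); dset_tac
      | H : forall x, dfun _ _ _ |- _ => eapply (dfun_comp (H _)); dset_tac
      end]
  | |- dset _ (fun _ => True) => change (dtype _); dset_tac
  | |- dset _ (fun u => _ /\ _) => apply: dset_and; dset_tac
  | |- dset _ (fun u => _ \/ _) => apply: dset_or; dset_tac
  | |- dset _ (fun u => ~ _) => apply: dset_not; dset_tac
  | |- dset _ (fun u => exists y, _) =>
      match goal with
      | H : dtype ?d |- _ => apply: (dset_ex (d := d)); dset_tac
      end
  | |- dset _ (fun u => _ = _) =>
      match goal with
      | H : dtype ?d |- _ => apply: (dset_eq (d := d)); dset_tac
      end
  | |- dset _ (fun u => forall y, _) => first [
      match goal with
      | H : dtype ?d |- _ =>
          apply: (dset_all (d := d)); [dset_tac | dset_tac | dset_tac]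
      end | apply: dset_imp; [dset_tac | dset_tac | dset_tac]]
  | |- dset _ _ => first [assumption |
      match goal with
      | H : dset _ _ |- _ => eapply (dset_preim H); dset_tac
      end]
  | |- _ => idtac
  end.

(** * Subgroups, index, rank and chain conditions *)

Section Index.
Implicit Types G : zmodType.

Lemma subrBBr G (u x y : G) : (x - u) - (y - u) = x - y.
Proof. by rewrite opprB addrA subrK. Qed.

Lemma subrBBl G (u x y : G) : (u - x) - (u - y) = y - x.
Proof. by rewrite opprB addrC addrA subrK. Qed.

Lemma subgroup0 G (H : set G) : subgroup H -> H 0. Proof. by case. Qed.

Lemma subgroupB G (H : set G) x y : subgroup H -> H x -> H y -> H (x - y).
Proof. by case=> _; apply. Qed.

Lemma subgroupN G (H : set G) x : subgroup H -> H x -> H (- x).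
Proof. by move=> sH Hx; rewrite -sub0r; apply: subgroupB => //; case: sH. Qed.

Lemma subgroupD G (H : set G) x y : subgroup H -> H x -> H y -> H (x + y).
Proof.
by move=> sH Hx Hy; rewrite -[y]opprK; apply: subgroupB => //; apply: subgroupN.
Qed.

Lemma subgroupT G : subgroup [set: G]. Proof. by []. Qed.

Lemma subgroup1 G : subgroup [set (0 : G)].
Proof. by split=> // x y /= -> ->; rewrite subrr. Qed.

Lemma subgroupI G (H K : set G) :
  subgroup H -> subgroup K -> subgroup (fun x => H x /\ K x).
Proof.
move=> sH sK; split; first by split; apply: subgroup0.
by move=> x y [Hx Kx] [Hy Ky]; split; apply: subgroupB.
Qed.

Lemma subgroup_preim G G' (f : G -> G') (K : set G') :
  {morph f : x y / x - y} -> subgroup K -> subgroup (fun x => K (f x)).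
Proof.
move=> fB sK; split=> [|x y Kx Ky]; last by rewrite fB; apply: subgroupB.
by rewrite -(subrr 0) fB subrr; apply: subgroup0.
Qed.

Lemma subgroup_image G G' (f : G -> G') (H : set G) :
  {morph f : x y / x - y} -> subgroup H -> subgroup (f @` H).
Proof.
move=> fB sH; split=> [|_ _ [x Hx <-] [y Hy <-]].
  by exists 0; [apply: subgroup0|rewrite -(subrr 0) fB subrr].
by exists (x - y); [apply: subgroupB|rewrite fB].
Qed.

Lemma finite_index_refl G (H : set G) : finite_index H H.
Proof. by exists [:: 0] => w Hw; exists 0; rewrite ?inE ?subr0. Qed.

Lemma finite_index_sub G (H H' W W' : set G) :
  H `<=` H' -> W' `<=` W -> finite_index H W -> finite_index H' W'.
Proof.
by move=> HH WW [s Hs]; exists s => w /WW/Hs[u us Hu]; exists u => //; apply: HH.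
Qed.

Lemma finite_index_trans G (H K W : set G) :
  finite_index H K -> finite_index K W -> finite_index H W.
Proof.
move=> [s Hs] [t Ht]; exists [seq x + y | x <- t, y <- s] => w /Ht[x xt /Hs[y ys h]].
exists (x + y); first by apply/allpairsP; exists (x, y).
by rewrite opprD addrA.
Qed.

(** Each representative [u] of a coset of [H] is replaced by some [g u] in [A] that [f] sends into
    that coset, if there is one. Two points sent into the same coset differ by an element of the
    preimage. *)
Lemma finite_index_preim G G' (f : G -> G') (A : set G) (H B : set G') :
  {morph f : x y / x - y} -> subgroup H -> (forall x, A x -> B (f x)) ->
  finite_index H B -> finite_index (fun x => H (f x)) A.
Proof.
move=> fB sH AB [s Hs].
have g0 u : exists x', (exists2 x, A x & H (f x - u)) -> H (f x' - u).
  have [[x Ax Hx]|nx] := pselect (exists2 x, A x & H (f x - u)).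
    by exists x.
  by exists 0 => /nx.
have [g gP] := choice g0.
exists [seq g u | u <- s] => x Ax; have [u us Hu] := Hs _ (AB _ Ax).
exists (g u); first by apply/mapP; exists u.
rewrite fB -(subrBBr u); apply: subgroupB => //; apply: gP.
by exists x.
Qed.

(** A coset of [H] and a coset of [K] that meet do so in one coset of the intersection; [g] chooses
    a point in it. *)
Lemma finite_indexI G (H K W : set G) : subgroup H -> subgroup K ->
  finite_index H W -> finite_index K W ->
  finite_index (fun x => H x /\ K x) W.
Proof.
move=> sH sK [s Hs] [t Kt].
pose P (u v : G) x := H (x - u) /\ K (x - v).
have g0 (u : G * G) : exists x, (exists x, P u.1 u.2 x) -> P u.1 u.2 x.
  have [[x h]|nx] := pselect (exists x, P u.1 u.2 x); first by exists x.
  by exists 0 => /nx.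
have [g gP] := choice g0.
exists [seq g (u, v) | u <- s, v <- t] => w Ww.
have [u us Hu] := Hs _ Ww; have [v vt Kv] := Kt _ Ww.
have [|Hg Kg] := gP (u, v); first by exists w.
exists (g (u, v)); first by apply/allpairsP; exists (u, v).
by split; [rewrite -(subrBBr u)|rewrite -(subrBBr v)]; apply: subgroupB.
Qed.

(** Infinity is expressed by the index of the trivial group, so that transitivity and preimages of
    finite index apply to it directly. *)
Definition infinite_group G (W : set G) : Prop := ~ finite_index [set 0] W.

Lemma infinite_groupP G (W : set G) : infinite_group W <-> infinite_set W.
Proof.
split=> [infW finW|infW [s Hs]].
  apply: infW; have /finite_seqP[s Ws] := finW; exists s => w Ww; exists w.
    by move: Ww; rewrite Ws.
  by rewrite subrr.
apply: infW; apply: (@sub_finite_set _ _ [set` s]); last exact: finite_seq.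
by move=> w /Hs[u us /eqP]; rewrite subr_eq0 => /eqP ->.
Qed.

Lemma infinite_sub G (W W' : set G) :
  W `<=` W' -> infinite_group W -> infinite_group W'.
Proof. by move=> WW infW finW; apply: infW; apply: finite_index_sub finW. Qed.

Lemma infinite_index G (H W : set G) :
  finite_index H W -> infinite_group W -> infinite_group H.
Proof. by move=> finH infW finH1; apply: infW; apply: finite_index_trans finH. Qed.

Lemma infinite_neq0 G (W : set G) : infinite_group W -> exists2 w, W w & w <> 0.
Proof.
move=> infW; apply: contrapT => H; apply: infW; exists [:: 0] => w Ww.
exists 0; rewrite ?inE // subr0; apply: contrapT => w0; apply: H.
by exists w.
Qed.

End Index.

(** * Rank of definable sets in a group and the descending chain condition *)

Section Rank.
Variables (L : language) (M : structure L) (G : zmodType) (c : coordinates M G).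
Hypotheses (c_def : dtype c) (c_add : definable_fun2 c c c (+%R : G -> G -> G)).

Lemma dfun_opp : dfun c c (-%R : G -> G).
Proof.
apply: (dset_ext (P := fun u : G * G => u.1 + u.2 = 0)); last by dset_tac.
move=> [x y] /=; split=> [/eqP|<-]; last by rewrite subrr.
by rewrite addr_eq0 => /eqP ->; rewrite opprK.
Qed.

Definition dsub (H : set G) : Prop := subgroup H /\ dset c H.

(** The pieces are definable in [M] itself, with no passage to a saturated extension. This bounds
    Morley rank from below, which is the direction needed to contradict a rank bound. *)
Fixpoint rank_ge (k : nat) (A : set G) : Prop :=
  if k is k'.+1 then
    exists Y : nat -> set G,
      [/\ forall i, dset c (Y i), trivIset [set: nat] Y,
          forall i, Y i `<=` A & forall i, rank_ge k' (Y i)]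
  else A !=set0.

Lemma rank_ge_sub k A B : A `<=` B -> rank_ge k A -> rank_ge k B.
Proof.
case: k => [|k] AB /=; first by move=> [x /AB]; exists x.
by move=> [Y [h1 h2 h3 h4]]; exists Y; split=> // i x /h3/AB.
Qed.

Lemma rank_ge_le j k A : (j <= k)%N -> rank_ge k A -> rank_ge j A.
Proof.
move=> /subnK <-; elim: (k - j)%N => // d IH [Y [_ _ YA rkY]].
by apply: IH; apply: rank_ge_sub (YA 0%N) (rkY 0%N).
Qed.

Lemma rank_ge_coord k A : rank_ge k A -> rank_ge_in k (c @` A).
Proof.
elim: k A => [|k IH] A /=; first by move=> [x Ax]; exists (c x), x.
move=> [Y [h1 h2 h3 h4]]; exists (fun i => c @` Y i); split=> //.
- move=> i j _ _ [_ [[x Yx <-] [y Yy E]]]; apply: h2 => //.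
  by exists x; split=> //; rewrite -(coord_inj E).
- by move=> i; apply: image_subset.
- by move=> i; apply: IH.
Qed.

Lemma rank_ge_translate k A x : rank_ge k A -> rank_ge k (fun y => A (y - x)).
Proof.
have c_opp := dfun_opp.
elim: k A => [|k IH] A /=; first by move=> [y Ay]; exists (y + x); rewrite addrK.
move=> [Y [h1 h2 h3 h4]]; exists (fun i y => Y i (y - x)); split.
- by move=> i; have h1i := h1 i; dset_tac.
- by move=> i j _ _ [y [Yi Yj]]; apply: h2 => //; exists (y - x).
- by move=> i y /h3.
- by move=> i; apply: IH.
Qed.

(** Infinitely many disjoint cosets of [H] fit into [W], each of rank at least [k]. The list [s i]
    holds the representatives chosen so far, and [g] returns a point outside all their cosets. *)
Lemma rank_ge_index k (H W : set G) : dsub H -> subgroup W -> H `<=` W ->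
  ~ finite_index H W -> rank_ge k H -> rank_ge k.+1 W.
Proof.
move=> [sH dH] sW HW ninf rkH; have c_opp := dfun_opp.
have next (s : seq G) : exists w, W w /\ forall u, u \in s -> ~ H (w - u).
  apply: contrapT => N; apply: ninf; exists s => w Ww; apply: contrapT => N'.
  by apply: N; exists w; split=> // u us Hu; apply: N'; exists u.
have [g gP] := choice next.
pose s i := iter i (fun l => g l :: l) [::].
have sP i j : (i < j)%N -> g (s i) \in s j.
  elim: j => // j IH; rewrite ltnS leq_eqVlt inE => /orP[/eqP->|/IH ->].
    by rewrite eqxx.
  by rewrite orbT.
exists (fun i y => H (y - g (s i))); split.
- by move=> i; dset_tac.
- have disj i j y : (i < j)%N -> H (y - g (s i)) -> ~ H (y - g (s j)).
    move=> /sP ij Hi Hj; have [_ /(_ _ ij)] := gP (s j); apply.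
    by rewrite -(subrBBl y); apply: subgroupB.
  move=> i j _ _ [y [Hi Hj]]; apply/eqP.
  by case: ltngtP => // h; [case: (disj _ _ y h)|case: (disj _ _ y h)].
- move=> i y /HW Wy; rewrite -[y](subrK (g (s i))); apply: subgroupD => //.
  by case: (gP (s i)).
- by move=> i; apply: rank_ge_translate.
Qed.

Definition dcc : Prop := forall C : set (set G), C !=set0 ->
  (forall H, C H -> dsub H) ->
  exists H, C H /\ forall H', C H' -> H' `<=` H -> H `<=` H'.

(** Take a member [H] of least rank. A strictly descending sequence [K i] below it would give cosets
    of [K i.+1] inside [K i] but off [K i.+1]. These are disjoint and have the rank of [H], so [H]
    would have larger rank. *)
Lemma dcc_of_rank r : ~ rank_ge r [set: G] -> dcc.
Proof.
move=> nrk C [H0 CH0] Cd; have c_opp := dfun_opp.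
pose P k := `[< exists2 H, C H & ~ rank_ge k H >].
have exP : exists k, P k.
  exists r; apply/asboolP; exists H0 => // h; apply: nrk.
  by apply: rank_ge_sub h.
case: (ex_minnP exP) => k /asboolP[H CH nrkH] kmin.
have rkC K j : C K -> (j < k)%N -> rank_ge j K.
  move=> CK lt_jk; apply: contrapT => nrkK.
  have /kmin : P j by apply/asboolP; exists K.
  by rewrite leqNgt lt_jk.
case: k => [|k] in nrkH kmin rkC *.
  by case: nrkH; exists 0; apply: subgroup0; case: (Cd _ CH).
apply: contrapT => N.
have next (K : set G) : exists K', C K -> K `<=` H ->
    [/\ C K', K' `<=` K & exists2 x, K x & ~ K' x].
  have [[CK KH]|n] := pselect (C K /\ K `<=` H); last first.
    by exists K => CK KH; case: n.
  apply: contrapT => N'; apply: N; exists K; split=> // K' CK' K'K x Kx.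
  by apply: contrapT => nK'x; apply: N'; exists K' => _ _; split=> //; exists x.
have [nx nxP] := choice next.
pose K i := iter i nx H.
have KP i : C (K i) /\ K i `<=` H.
  elim: i => [|i [CK KH]] /=; first by split=> // x.
  by have [h1 h2 _] := nxP _ CK KH; split=> // x /h2/KH.
have KS i : K i.+1 `<=` K i by have [CK KH] := KP i; have [] := nxP _ CK KH.
have Kx i : exists x, K i x /\ ~ K i.+1 x.
  by have [CK KH] := KP i; have [_ _ [x h1 h2]] := nxP _ CK KH; exists x.
have [x xP] := choice Kx.
have Kle i j : (i <= j)%N -> K j `<=` K i.
  by move=> /subnK <-; elim: (j - i)%N => //= d IHd y /KS/IHd.
have sK i : subgroup (K i) by have [CK _] := KP i; case: (Cd _ CK).
apply: nrkH; exists (fun i y => K i.+1 (y - x i)); split.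
- move=> i; have [CK _] := KP i.+1; have [_ dK] := Cd _ CK; dset_tac.
- have disj i j y : (i < j)%N -> K i.+1 (y - x i) -> ~ K j.+1 (y - x j).
    move=> ij h1 /KS/(Kle _ _ ij) h2; have [xi nxi] := xP i; apply: nxi.
    have [xj _] := xP j; have {}xj := Kle _ _ ij _ xj.
    have -> : x i = y - (y - x i) by rewrite opprB addrC subrK.
    apply: subgroupB => //; rewrite -[y](subrK (x j)).
    exact: subgroupD.
  move=> i j _ _ [y [Hi Hj]]; apply/eqP.
  by case: ltngtP => // h; [case: (disj _ _ y h)|case: (disj _ _ y h)].
- move=> i y /KS h; have [_] := KP i; apply; rewrite -[y](subrK (x i)).
  by apply: subgroupD => //; case: (xP i).
- by move=> i; apply: rank_ge_translate; apply: rkC => //; case: (KP i.+1).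
Qed.

Lemma dsubT : dsub [set: G]. Proof. by split; [exact: subgroupT|]. Qed.

Lemma dsubI H K : dsub H -> dsub K -> dsub (fun x => H x /\ K x).
Proof.
by move=> [sH dH] [sK dK]; split; [exact: subgroupI|exact: dset_and].
Qed.

Hypothesis c_dcc : dcc.

(** Let [K] be minimal among the definable subgroups containing the intersection. Cutting [K] with a
    member of [C] stays in this family, so [K] lies in every member. *)
Lemma dsub_bigcap (C : set (set G)) : (forall H, C H -> dsub H) ->
  dsub (fun x => forall H, C H -> H x).
Proof.
move=> Cd; have [||K [[dK capK] Kmin]] := @c_dcc
    (fun K => dsub K /\ forall x, (forall H, C H -> H x) -> K x).
- by exists [set: G]; split=> //; exact: dsubT.
- by move=> K [].
suff -> : (fun x => forall H, C H -> H x) = K by [].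
apply/seteqP; split=> [//|x Kx H CH].
suff : (fun x => K x /\ H x) x by case.
apply: (Kmin (fun x => K x /\ H x)) => // [|y []//]; split=> [|y h]; last by split; [exact: capK|exact: h].
by apply: dsubI => //; apply: Cd.
Qed.

Lemma connected_component (U : set G) : dsub U -> exists U0,
  [/\ dsub U0, U0 `<=` U, finite_index U0 U
    & forall H, dsub H -> finite_index H U0 -> U0 `<=` H].
Proof.
move=> dU; have [||K [[dK KU fK] Kmin]] := @c_dcc
    (fun K => [/\ dsub K, K `<=` U & finite_index K U]).
- by exists U; split=> //; exact: finite_index_refl.
- by move=> K [].
exists K; split=> // H dH fH x Kx.
suff : (fun x => K x /\ H x) x by case.
apply: (Kmin (fun x => K x /\ H x)) => // [|y []//]; split; first exact: dsubI.
  by move=> y [/KU].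
apply: finite_index_trans fK; apply: finite_indexI => //.
- by case: dK.
- by case: dH.
- exact: finite_index_refl.
Qed.

End Rank.

(** * Chain condition on the Lie ring *)

Section LieChain.
Variables (L : language) (M : structure L).
Variables (g V : zmodType) (cg : coordinates M g) (cV : coordinates M V).
Variable rho : g -> {additive V -> V}.
Hypothesis cg_def : dtype cg.
Hypotheses (cV_def : dtype cV) (cV_add : definable_fun2 cV cV cV (+%R : V -> V -> V)).
Hypothesis rho_def : definable_fun2 cg cV cV (fun x v => rho x v).
Hypothesis rhoD : forall x y v, rho (x + y) v = rho x v + rho y v.
Hypothesis rho_inj : forall x y, rho x =1 rho y -> x = y.
Hypothesis no_ladder_V : forall E : V * g -> Prop, dset (coord_pair cV cg) E ->
  forall (v : nat -> V) (x : nat -> g), ~ forall i j, E (v i, x j) <-> (i <= j)%N.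
Hypothesis V_dcc : dcc cV.

Lemma rho0 v : rho 0 v = 0.
Proof. by apply: (addIr (rho 0 v)); rewrite -rhoD !add0r. Qed.

Lemma rhoB x y v : rho (x - y) v = rho x v - rho y v.
Proof. by apply: (addIr (rho y v)); rewrite -rhoD !subrK. Qed.

Lemma rho_eq0 x : (forall v, rho x v = 0) -> x = 0.
Proof. by move=> H; apply: rho_inj => v; rewrite H rho0. Qed.

(* If every finite set had a nonzero annihilator, then a sequence of pairs
   [(w_i, x_i)] with [x_j w_i = 0] iff [i <= j] could be built; such pairs are
   stored here most recent first. *)
Let link (z y : V * g) := (rho z.2 y.1 == 0) && (rho y.2 z.1 != 0).

(** The point [w] is corrected from the newest pair to the oldest. If the next [y.2] kills [w], then
    [z.1] is added, where [z] is the pair just before [y]: [y.2] does not kill [z.1], while [z.2]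
    and all newer elements do. *)
Lemma avoid_annihilators s1 s2 z w :
  pairwise link (s1 ++ z :: s2) ->
  all (fun y : V * g => rho y.2 y.1 == 0) (s1 ++ z :: s2) ->
  all (fun y => rho y.2 w != 0) (rcons s1 z) ->
  exists w', all (fun y => rho y.2 w' != 0) (s1 ++ z :: s2).
Proof.
elim: s2 s1 z w => [|y s2 IH] s1 z w; first by rewrite cats1; exists w.
rewrite -cat_rcons => lk self nk.
have [yw|nyw] := eqVneq (rho y.2 w) 0; last first.
  by apply: (IH _ _ w) => //; rewrite all_rcons nyw nk.
apply: (IH _ _ (w + z.1)) => //; rewrite all_rcons raddfD yw add0r.
move: lk; rewrite pairwise_cat allrel_consr => /and3P[/andP[lky _] lks _].
apply/andP; split.
  by move: lky; rewrite all_rcons => /andP[/andP[]].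
apply/allP => t tin; rewrite raddfD.
suff -> : rho t.2 z.1 = 0 by rewrite addr0; move/allP: nk; apply.
move: tin; rewrite mem_rcons inE => /predU1P[->|tin].
  by move: self; rewrite all_cat all_rcons => /andP[/andP[/eqP]].
move: lks; rewrite -cats1 pairwise_cat allrel1r => /andP[/allP/(_ _ tin)].
by case/andP=> /eqP.
Qed.

Lemma finite_faithful : exists s : seq V, forall x : g,
  (forall v, v \in s -> rho x v = 0) -> x = 0.
Proof.
apply: contrapT => N.
have ann (s : seq V) : exists x : g, x != 0 /\ forall v, v \in s -> rho x v = 0.
  apply: contrapT => N'; apply: N; exists s => x sx; apply: contrapT => /eqP x0.
  by apply: N'; exists x.
have nz (x : g) : x != 0 -> exists u, rho x u != 0.
  move=> /eqP x0; apply: contrapT => N'; apply: x0; apply: rho_eq0 => v.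
  by apply: contrapT => /eqP h; apply: N'; exists v.
pose good s := [/\ pairwise link s, all (fun y : V * g => rho y.2 y.1 == 0) s
  & exists z s', s = z :: s' /\ z.2 != 0].
have next s : exists z, good s -> good (z :: s).
  have [[lk self [z [s' [E z0]]]]|n] := pselect (good s); last by exists (0, 0).
  (* [u] escapes the newest element of the list and is corrected to a [w] escaping all of them; the
     new [x] is then taken nonzero and killing [w] together with all older points. *)
  have [u zu] := nz _ z0.
  have [||/=|w nkw] := @avoid_annihilators [::] s' z u; rewrite -?E //=.
    by rewrite zu.
  have [x [x0 xs]] := ann (w :: map fst s).
  exists (w, x) => _; split; last by exists (w, x), s.
    rewrite pairwise_cons lk andbT; apply/allP => y ys; rewrite /link /=.
    rewrite (allP nkw) -?E // andbT xs ?eqxx // inE; apply/orP; right.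
    by apply/mapP; exists y.
  by rewrite /= self xs ?eqxx ?inE ?eqxx.
have [nx nxP] := choice next; have [x0 [x00 _]] := ann [::].
pose st i := iter i (fun s => nx s :: s) [:: (0, x0)].
have st_good i : good (st i).
  elim: i => [|i IH]; last exact: nxP.
  by split; rewrite //= ?raddf0 ?eqxx //; exists (0, x0), [::].
pose z i := nx (st i).
have zin i j : (i < j)%N -> z i \in st j.
  elim: j => // j IH; rewrite ltnS leq_eqVlt inE => /predU1P[->|/IH ->].
    by rewrite eqxx.
  by rewrite orbT.
have lk i j : (i < j)%N -> link (z j) (z i).
  move=> ij; have [] := st_good j.+1; rewrite /= => /andP[/allP h _] _ _.
  by apply: h; apply: zin.
have self i : rho (z i).2 (z i).1 = 0.
  by have [] := st_good i.+1; rewrite /= => _ /andP[/eqP].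
have dE : dset (coord_pair cV cg) (fun u => rho u.2 u.1 = 0) by dset_tac.
apply: (no_ladder_V dE (v := fun i => (z i).1) (x := fun i => (z i).2)) => i j /=.
have [/lk/andP[/eqP -> _]|/lk/andP[_ /eqP h]|->] := ltngtP i j => //.
Qed.

(** Evaluation at the points of [s] is injective on [g]. By induction on the list, one first
    minimizes the image under evaluation at [v], then the kernel of this evaluation among the
    members with that image. *)
Lemma lie_dcc : dcc cg.
Proof.
have [s sP] := finite_faithful.
suff H (t : seq V) (C : set (set g)) : C !=set0 -> (forall H, C H -> dsub cg H) ->
    (forall H x, C H -> H x -> (forall v, v \in t -> rho x v = 0) -> x = 0) ->
    exists H, C H /\ forall H', C H' -> H' `<=` H -> H `<=` H'.
  by move=> C C0 Cd; apply: (H s) => // K x _ _; apply: sP.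
elim: t C => [|v t IH] C [K0 CK0] Cd Ct.
  exists K0; split=> // H' CH' _ x K0x.
  by rewrite (Ct _ _ CK0 K0x) //; apply: subgroup0; case: (Cd _ CH').
pose ev x := rho x v.
have evB : {morph ev : x y / x - y} by move=> x y; exact: rhoB.
have dev : dfun cg cV ev by rewrite /ev; dset_tac.
have [||U [[H0 CH0 UE] Umin]] := @V_dcc [set ev @` H | H in C].
- by exists (ev @` K0), K0.
- move=> _ [H CH <-]; have [sH dH] := Cd _ CH.
  by split; [exact: subgroup_image|exact: (dset_image cg_def)].
have [|||K [[H1 [CH1 H1U <-]] Kmin]] := IH (fun K => exists H,
    [/\ C H, ev @` H = U & (fun x => H x /\ ev x = 0) = K]).
- by exists (fun x => H0 x /\ ev x = 0), H0.
- move=> _ [H [CH HU <-]]; have [sH dH] := Cd _ CH; split; last by dset_tac.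
  by apply: subgroupI => //; apply: (subgroup_preim (K := [set 0])) => //; exact: subgroup1.
- move=> _ x [H [CH _ <-]] [Hx xv] xt; apply: (Ct H) => // w.
  by rewrite inE => /predU1P[->//|]; exact: xt.
exists H1; split=> // H' CH' H'H x H1x.
have UH' : U `<=` ev @` H'.
  by apply: Umin; [exists H'|rewrite -H1U; exact: image_subset].
have HU' : ev @` H' = U.
  by apply/seteqP; split=> //; rewrite -H1U; exact: image_subset.
have [y H'y yx] : (ev @` H') (ev x) by apply: UH'; rewrite -H1U; exists x.
have [sH1 _] := Cd _ CH1; have [sH' _] := Cd _ CH'.
rewrite -[x](subrK y); apply: subgroupD => //.
suff : H' (x - y) /\ ev (x - y) = 0 by case.
apply: (Kmin (fun x => H' x /\ ev x = 0)); first by exists H'.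
  by move=> z [/H'H].
by split; [apply: subgroupB => //; exact: H'H|rewrite evB yx subrr].
Qed.

End LieChain.

(** * The field of scalars *)

(* A subgroup [W] of [V] on which a field of endomorphisms of [V] acts simply
   transitively; the endomorphism [f] is represented by [f w], with [w] the
   base point. *)
Record scalar_line (V : zmodType) := ScalarLine {
  sl_set : set V;
  sl_one : V;
  sl_act : V -> V -> V;
  sl_sub : subgroup sl_set;
  sl_one_in : sl_set sl_one;
  sl_one_neq0 : sl_one <> 0;
  sl_in : forall u v, sl_set u -> sl_set v -> sl_set (sl_act u v);
  sl_addl : forall u u' v, sl_set u -> sl_set u' ->
    sl_act (u + u') v = sl_act u v + sl_act u' v;
  sl_addr : forall u v v', sl_set u -> sl_act u (v + v') = sl_act u v + sl_act u v';
  sl_assoc : forall u u' v, sl_set u -> sl_set u' ->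
    sl_act u (sl_act u' v) = sl_act (sl_act u u') v;
  sl_act1 : forall v, sl_act sl_one v = v;
  sl_comm : forall u u', sl_set u -> sl_set u' -> sl_act u u' = sl_act u' u;
  sl_inv : forall u, sl_set u -> u <> 0 ->
    exists u', sl_set u' /\ sl_act u' u = sl_one
}.

Section ScalarField.
Variables (V : zmodType) (l : scalar_line V).

Definition sl_pred : pred V := fun u => `[< sl_set l u >].

Record scalar_field := ScalarField { sf_val : V; _ : sl_pred sf_val }.

HB.instance Definition _ := [isSub for sf_val].
HB.instance Definition _ := [Choice of scalar_field by <:].

Lemma sfP (k : scalar_field) : sl_set l (sf_val k).
Proof. by case: k => u /= /asboolP. Qed.

Definition sf (u : V) (h : sl_set l u) : scalar_field := ScalarField (asboolT h).

Let sub_l := sl_sub l.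

Definition sf_zero := sf (subgroup0 sub_l).
Definition sf_opp k := sf (subgroupN sub_l (sfP k)).
Definition sf_add k k' := sf (subgroupD sub_l (sfP k) (sfP k')).
Definition sf_one := sf (sl_one_in l).
Definition sf_mul k k' := sf (sl_in (sfP k) (sfP k')).

Lemma sf_addA : associative sf_add.
Proof. by move=> x y z; apply: val_inj; rewrite /= addrA. Qed.
Lemma sf_addC : commutative sf_add.
Proof. by move=> x y; apply: val_inj; rewrite /= addrC. Qed.
Lemma sf_add0 : left_id sf_zero sf_add.
Proof. by move=> x; apply: val_inj; rewrite /= add0r. Qed.
Lemma sf_addN : left_inverse sf_zero sf_opp sf_add.
Proof. by move=> x; apply: val_inj; rewrite /= addNr. Qed.

HB.instance Definition _ :=
  GRing.isZmodule.Build scalar_field sf_addA sf_addC sf_add0 sf_addN.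

Lemma sf_mulA : associative sf_mul.
Proof.
by move=> x y z; apply: val_inj; rewrite /= sl_assoc //; exact: sfP.
Qed.
Lemma sf_mulC : commutative sf_mul.
Proof. by move=> x y; apply: val_inj; rewrite /= sl_comm //; exact: sfP. Qed.
Lemma sf_mul1 : left_id sf_one sf_mul.
Proof. by move=> x; apply: val_inj; rewrite /= sl_act1. Qed.
Lemma sf_mulD : left_distributive sf_mul sf_add.
Proof. by move=> x y z; apply: val_inj; rewrite /= sl_addl //; exact: sfP. Qed.
Lemma sf_one_neq0 : sf_one != sf_zero.
Proof. by apply/eqP => /(congr1 sf_val) /=; exact: sl_one_neq0. Qed.

HB.instance Definition _ := GRing.Zmodule_isComNzRing.Build scalar_field
  sf_mulA sf_mulC sf_mul1 sf_mulD sf_one_neq0.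

Lemma sf_inv_subproof (k : scalar_field) :
  exists k', (k != 0 -> k' * k = 1) /\ (k = 0 -> k' = 0).
Proof.
have [->|k0] := eqVneq k 0; first by exists 0.
have [|u [h hu]] := sl_inv (sfP k).
  by move=> h; move/eqP: k0; apply; apply: val_inj.
exists (sf h); split=> [_|/eqP]; first exact: val_inj.
by rewrite (negPf k0).
Qed.

Definition sf_inv (k : scalar_field) : scalar_field :=
  projT1 (cid (sf_inv_subproof k)).

Lemma sf_mulV k : k != 0 -> sf_inv k * k = 1.
Proof. by rewrite /sf_inv; case: cid => k' []. Qed.

Lemma sf_inv0 : sf_inv 0 = 0.
Proof. by rewrite /sf_inv; case: cid => k' h; exact: h.2. Qed.

HB.instance Definition _ :=
  GRing.ComNzRing_isField.Build scalar_field sf_mulV sf_inv0.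

Definition sf_scale (k : scalar_field) (v : V) : V := sl_act l (sf_val k) v.

Lemma sf_scaleA (a b : scalar_field) v :
  sf_scale a (sf_scale b v) = sf_scale (a * b) v.
Proof. by rewrite /sf_scale sl_assoc //; exact: sfP. Qed.
Lemma sf_scale1 : left_id 1 sf_scale.
Proof. by move=> v; exact: sl_act1. Qed.
Lemma sf_scaleDr : right_distributive sf_scale +%R.
Proof. by move=> k u v; rewrite /sf_scale sl_addr //; exact: sfP. Qed.
Lemma sf_scaleDl v : {morph sf_scale^~ v : a b / a + b}.
Proof. by move=> a b; rewrite /sf_scale sl_addl //; exact: sfP. Qed.

Definition sf_scaling : scaling scalar_field V :=
  Scaling sf_scaleA sf_scale1 sf_scaleDr sf_scaleDl.

Variables (L : language) (M : structure L) (c : coordinates M V).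

Lemma sf_coord_inj : injective (fun k : scalar_field => c (sf_val k)).
Proof. by move=> k k' E; apply: val_inj; exact: coord_inj E. Qed.

Definition sf_coord : coordinates M scalar_field := Coordinates sf_coord_inj.

Hypotheses (c_def : dtype c) (c_add : definable_fun2 c c c (+%R : V -> V -> V)).
Hypothesis line_def : dset c (sl_set l).
Hypothesis act_def : dset (coord_pair c (coord_pair c c))
  (fun t => sl_set l t.1 /\ sl_act l t.1 t.2.1 = t.2.2).

Lemma sf_dtype : dtype sf_coord.
Proof.
rewrite /dtype /dset /definable_in; have := line_def; rewrite /dset /definable_in.
suff -> : (sf_coord @` (fun=> True)) = (c @` sl_set l) by [].
apply/seteqP; split=> [_ [k _ <-]|_ [u lu <-]]; first by exists (sf_val k) => //; exact: sfP.
by exists (sf lu).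
Qed.

(** In coordinates, the graph of the inclusion and the diagonal of the field are the same set of
    tuples. *)
Lemma sf_dfun_val : dfun sf_coord c sf_val.
Proof.
have dK := dfun_id sf_dtype.
rewrite /dfun /dset /definable_in in dK *.
suff <- : (coord_pair sf_coord sf_coord) @` (fun u => u.1 = u.2) =
   (coord_pair sf_coord c) @` (fun u => sf_val u.1 = u.2) by [].
apply/seteqP; split=> [_ [[k k'] /= <- <-]|_ [[k u] /= <- <-]].
  by exists (k, sf_val k).
by exists (k, k).
Qed.

Lemma sf_definable_field : definable_field sf_coord.
Proof.
have dK := sf_dtype; have dval := sf_dfun_val.
split; [split|].
- exact: dK.
- apply: (dset_ext (P := fun u : scalar_field * scalar_field * scalar_field =>
    sf_val u.1.1 + sf_val u.1.2 = sf_val u.2)); last by dset_tac.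
  by move=> [[k k'] k''] /=; split=> [h|<-//]; exact: val_inj.
- apply: (dset_ext (P := fun u : scalar_field * scalar_field * scalar_field =>
    sl_set l (sf_val u.1.1) /\ sl_act l (sf_val u.1.1) (sf_val u.1.2) = sf_val u.2)).
    move=> [[k k'] k''] /=; split=> [[_ h]|<-]; first exact: val_inj.
    by split=> //; exact: sfP.
  apply: (dset_preim (f := fun u => (sf_val u.1.1, (sf_val u.1.2, sf_val u.2))) act_def).
  by dset_tac.
Qed.

Lemma sf_definable_scale : definable_fun2 sf_coord c c sf_scale.
Proof.
have dK := sf_dtype; have dval := sf_dfun_val.
apply: (dset_ext (P := fun u : scalar_field * V * V =>
    sl_set l (sf_val u.1.1) /\ sl_act l (sf_val u.1.1) u.1.2 = u.2)).
  move=> [[k v] v'] /=; split=> [[]//|<-]; split=> //; exact: sfP.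
apply: (dset_preim (f := fun u => (sf_val u.1.1, (u.1.2, u.2))) act_def).
by dset_tac.
Qed.

(** The images of the iterates of Frobenius descend, so two consecutive ones agree; injectivity of
    Frobenius then cancels the iterate and leaves surjectivity. *)
Lemma sf_perfect (p : nat) : prime p -> (forall v : V, v *+ p = 0) -> dcc c ->
  forall k : scalar_field, exists k', k = k' ^+ p.
Proof.
move=> p_prime Vp c_dcc.
have dK := sf_dtype; have dval := sf_dfun_val; have [_ dmul] := sf_definable_field.
have valMn n (k : scalar_field) : sf_val (k *+ n) = sf_val k *+ n.
  by elim: n => // n IH; rewrite !mulrS -IH.
have charK : p \in [pchar scalar_field].
  by rewrite inE p_prime; apply/eqP/val_inj; rewrite /= valMn Vp.
pose frob (k : scalar_field) := k ^+ p.
have frobB : {morph frob : x y / x - y}.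
  move=> x y; rewrite /frob -!(pFrobenius_autE charK).
  by rewrite pFrobenius_autB_comm //; exact: mulrC.
have frob_inj : injective frob.
  move=> x y /eqP; rewrite -subr_eq0 -frobB expf_eq0 => /andP[_].
  by rewrite subr_eq0 => /eqP.
have dfrob : dfun sf_coord sf_coord frob.
  rewrite /frob; elim: (p) => [|n IH]; first by apply: dfun_const.
  have -> : (fun k : scalar_field => k ^+ n.+1) = (fun k => k * k ^+ n).
    by apply/funext => k; rewrite exprS.
  by apply: (dfun_app2 dmul) => //; exact: dfun_id.
pose F n (k : scalar_field) := sf_val (iter n frob k).
have FB n : {morph F n : x y / x - y}.
  move=> x y; rewrite /F (_ : iter n frob (x - y) = iter n frob x - iter n frob y) //.
  by elim: n => //= n ->; rewrite frobB.
have dF n : dfun sf_coord c (F n).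
  apply: (dfun_comp dval); elim: n => [|n IH]; first exact: dfun_id.
  exact: (dfun_comp dfrob).
have [||_ [[n _ <-] nmin]] := c_dcc (range (fun n => range (F n))).
- by exists (range (F 0%N)), 0%N.
- move=> _ [n _ <-]; split; first exact: subgroup_image.
  exact: (dset_image dK).
have sub : range (F n) `<=` range (F n.+1).
  apply: nmin; first by exists n.+1.
  by move=> _ [x _ <-]; exists (frob x); rewrite // /F -iterSr.
move=> k; have [|k' _ E] := sub (F n k); first by exists k.
exists k'; have iter_inj : injective (iter n frob).
  by elim: n {nmin sub E} => // n IH x y /= /frob_inj/IH.
by apply: iter_inj; apply: val_inj; rewrite /= -/(frob k') -iterSr.
Qed.

End ScalarField.

(** * The ring generated by an abelian ideal *)

Lemma subrACA (G : zmodType) (a b c d : G) : (a - b) - (c - d) = (a - c) - (b - d).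
Proof. by rewrite !opprB addrACA [RHS]addrACA [- b + _]addrC. Qed.

Section Ring.
Variables (L : language) (M : structure L).
Variables (g : lieRingType) (V : zmodType) (cg : coordinates M g)
  (cV : coordinates M V).
Variable rho : g -> {additive V -> V}.
Hypothesis cg_def : dtype cg.
Hypotheses (cV_def : dtype cV) (cV_add : definable_fun2 cV cV cV (+%R : V -> V -> V)).
Hypothesis rho_def : definable_fun2 cg cV cV (fun x v => rho x v).
Hypothesis rho_act : lie_action rho.
Hypothesis rho_inj : faithful rho.
Hypothesis V_dcc : dcc cV.
Hypothesis V_conn : connected cV [set: V].
Hypothesis V_irr : irreducible_module cV rho.
Hypothesis V_neq0 : exists v : V, v <> 0.
Variable p : nat.
Hypotheses (p_prime : prime p) (Vp : forall v : V, v *+ p = 0).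
Hypothesis V_rank : ~ rank_ge cV p [set: V].

Let rhoD x y v : rho (x + y) v = rho x v + rho y v.
Proof. by case: rho_act. Qed.

Let rho_br x y v : rho (bracket x y) v = rho x (rho y v) - rho y (rho x v).
Proof. by case: rho_act. Qed.

Lemma full_of_finite_index H : dsub cV H -> finite_index H [set: V] -> forall v, H v.
Proof. by move=> [sH dH] fH v; rewrite (V_conn sH dH _ fH). Qed.

Lemma dsub0 : dsub cV [set 0].
Proof.
have c_opp := dfun_opp cV_def cV_add.
by split; [exact: subgroup1|apply: (dset_ext (P := fun x => x = 0)) => //; dset_tac].
Qed.

Lemma V_infinite : infinite_group [set: V].
Proof.
move=> finV; have [v v0] := V_neq0; apply: v0.
exact: (full_of_finite_index dsub0).
Qed.

(** Irreducibility only speaks of connected subgroups, so it is applied to the component [U0]. This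
    is invariant: the preimage of [U0] under [rho x] has finite index in [U], hence contains
    [U0]. *)
Lemma irreducible_infinite (U : set V) : dsub cV U -> infinite_group U ->
  (forall x u, U u -> U (rho x u)) -> forall v, U v.
Proof.
move=> dU infU gU; have [U0 [[sU0 dU0] U0U fU0 U0min]] := connected_component V_dcc dU.
have [sU dsU] := dU.
suff [E|E] : U0 = [set 0] \/ U0 = [set: V].
- by case: (infinite_index fU0 infU); rewrite E; exact: finite_index_refl.
- by move=> v; apply: U0U; rewrite E.
apply: V_irr => //.
  move=> H sH dH HU0 fH; apply/seteqP; split=> //; exact: U0min.
move=> x w U0w; have rx : dfun cV cV (rho x) by apply: (dfun_app2 rho_def); dset_tac.
have rxB : {morph rho x : u v / u - v} by move=> u v; exact: raddfB.
suff /(_ w U0w)[] : U0 `<=` (fun u => U u /\ U0 (rho x u)) by [].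
apply: U0min.
  split; first by apply: subgroupI => //; exact: subgroup_preim.
  by apply: dset_and => //; dset_tac.
apply: (finite_index_sub (H := fun u => U u /\ U0 (rho x u)) (W := U)) => //.
apply: finite_indexI => //; [exact: subgroup_preim|exact: finite_index_refl|].
by apply: (finite_index_preim rxB sU0 (B := U)) => // u; exact: gU.
Qed.

Definition dend (f : V -> V) : Prop := {morph f : x y / x - y} /\ dfun cV cV f.

Lemma dend_rho x : dend (rho x).
Proof.
by split=> [u v|]; [exact: raddfB|apply: (dfun_app2 rho_def); dset_tac].
Qed.

Lemma dend0 f : dend f -> f 0 = 0.
Proof. by case=> fB _; rewrite -{1}(subrr 0) fB subrr. Qed.

Lemma dend_comp f h : dend f -> dend h -> dend (fun v => f (h v)).
Proof. by move=> [fB df] [hB dh]; split=> [x y|]; [rewrite hB fB|dset_tac]. Qed.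

Lemma dsub_preim f H : dend f -> dsub cV H -> dsub cV (fun v => H (f v)).
Proof.
by move=> [fB df] [sH dH]; split; [exact: subgroup_preim|dset_tac].
Qed.

Lemma dsub_ker f : dend f -> dsub cV (fun v => f v = 0).
Proof. by move=> /dsub_preim/(_ dsub0). Qed.

Lemma dsub_image f H : dend f -> dsub cV H -> dsub cV (f @` H).
Proof.
by move=> [fB df] [sH dH]; split; [exact: subgroup_image|exact: (dset_image cV_def)].
Qed.

Lemma finite_kernel_of_image f (H : set V) : dend f -> subgroup H ->
  finite_index [set 0] (f @` H) -> finite_index (fun v => f v = 0) H.
Proof.
move=> [fB _] sH; apply: finite_index_preim => //; first exact: subgroup1.
Qed.

(** What Schur's lemma still gives when finite invariant subgroups are allowed. *)
Definition nearly_bijective (f : V -> V) : Prop :=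
  ~ infinite_group (fun v => f v = 0) /\ forall w, exists v, f v = w.

(** Kernel and image are invariant. An infinite kernel is all of [V]; a finite image makes the
    kernel of finite index, hence again all of [V] by connectedness. *)
Lemma schur f : dend f -> (forall x v, f (rho x v) = rho x (f v)) ->
  (forall v, f v = 0) \/ nearly_bijective f.
Proof.
move=> df fg; have [f0|f0] := pselect (forall v, f v = 0); [by left|right].
split.
  move=> infK; apply: f0; apply: (irreducible_infinite (dsub_ker df) infK).
  by move=> x u fu; rewrite fg fu raddf0.
move=> w; suff [v _ <-] : (f @` [set: V]) w by exists v.
apply: irreducible_infinite w.
- apply: dsub_image => //; exact: dsubT.
- move=> fin; apply: f0; apply: (full_of_finite_index (dsub_ker df)).
  exact: finite_kernel_of_image.
- by move=> x _ [v _ <-]; exists (rho x v).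
Qed.

(** From [f^p V] up to [V] the rank grows at each of the [p] steps. If [f^(j+1) V] had finite index
    in [f^j V], connectedness of [V] would give equality, so [f^j V = f^(p+j) V = 0], against
    [f^(p-1) <> 0] and [j < p]. *)
Lemma nilpotent_rank f : dend f -> (forall v, iter p f v = 0) ->
  (exists v, iter p.-1 f v <> 0) -> rank_ge cV p [set: V].
Proof.
move=> df fp0 [v fv]; have p0 := prime_gt0 p_prime.
have dit n : dend (iter n f).
  elim: n => [|n IH]; last exact: dend_comp.
  by split=> //; apply: dfun_id.
suff H k : (k <= p)%N -> rank_ge cV k (iter (p - k) f @` [set: V]).
  by apply: rank_ge_sub (H p (leqnn p)).
elim: k => [_|k IH lt_kp]; first by exists (iter (p - 0) f 0), 0.
have E : (p - k = (p - k.+1).+1)%N by rewrite subnS prednK // subn_gt0.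
set j := (p - k.+1)%N in E *.
have jp : (j <= p.-1)%N
  by rewrite /j subnS -!subn1 leq_sub2r // leq_subr.
have {}IH := IH (ltnW lt_kp); rewrite E in IH.
apply: (rank_ge_index cV_def cV_add _ _ _ _ IH).
- by apply: dsub_image => //; exact: dsubT.
- by case: (dsub_image (dit j) (dsubT cV_def)).
- by move=> _ [u _ <-]; exists (f u); rewrite // -iterSr.
have [itB _] := dit j.
have [sI _] := dsub_image (dit j.+1) (dsubT cV_def).
move=> /(finite_index_preim itB sI (A := [set: V])) fin.
have all_im u : (iter j.+1 f @` [set: V]) (iter j f u).
  apply: (full_of_finite_index (H := fun u => (iter j.+1 f @` [set: V]) (iter j f u))).
    by apply: dsub_preim => //; apply: dsub_image => //; exact: dsubT.
  by apply: fin => w _; exists w.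
have im n u : exists w, iter j f u = iter (n + j) f w.
  elim: n u => [|n IHn] u; first by exists u.
  have [w ->] := IHn u; have [z _ zw] := all_im w.
  by exists z; rewrite iterD -zw -iterD addnS addSn.
apply: fv; have [w] := im p v; rewrite iterD fp0.
have -> : p.-1 = (p.-1 - j + j)%N by rewrite subnK.
rewrite iterD => ->.
have [itB' _] := dit (p.-1 - j)%N; exact: dend0.
Qed.

Variable a : set g.
Hypothesis a_ideal : forall x y, a y -> a (bracket x y).
Hypothesis a_abelian : forall x y, a x -> a y -> bracket x y = 0.

Inductive gen_ring : (V -> V) -> Prop :=
| gen_in h : a h -> gen_ring (rho h)
| gen_id : gen_ring id
| gen_sub f h : gen_ring f -> gen_ring h -> gen_ring (fun v => f v - h v)
| gen_comp f h : gen_ring f -> gen_ring h -> gen_ring (fun v => f (h v)).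

Lemma gen_ext f h : f =1 h -> gen_ring f -> gen_ring h.
Proof. by move=> /funext ->. Qed.

Lemma gen_zero : gen_ring (fun=> 0).
Proof.
by apply: gen_ext (gen_sub gen_id gen_id) => v; rewrite subrr.
Qed.

Lemma gen_add f h : gen_ring f -> gen_ring h -> gen_ring (fun v => f v + h v).
Proof.
move=> Rf Rh; apply: gen_ext (gen_sub Rf (gen_sub gen_zero Rh)) => v.
by rewrite sub0r opprK.
Qed.

Lemma gen_iter n f : gen_ring f -> gen_ring (iter n f).
Proof.
by move=> Rf; elim: n => [|n IH]; [exact: gen_id|exact: gen_comp].
Qed.

Lemma gen_dend f : gen_ring f -> dend f.
Proof.
have c_opp := dfun_opp cV_def cV_add.
elim=> {f} [h _||f h _ [fB df] _ [hB dh]|f h _ df _ dh].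
- exact: dend_rho.
- by split=> //; apply: dfun_id.
- split=> [x y|]; last by dset_tac.
  by rewrite fB hB subrACA.
- exact: dend_comp.
Qed.

Lemma genB f x y : gen_ring f -> f (x - y) = f x - f y.
Proof. by case/gen_dend => fB _; exact: fB. Qed.

Lemma gen0 f : gen_ring f -> f 0 = 0.
Proof. by move/gen_dend; exact: dend0. Qed.

Lemma genD f x y : gen_ring f -> f (x + y) = f x + f y.
Proof. 
move=> Rf; have := genB x (- y) Rf; rewrite opprK => ->.
by have := genB 0 y Rf; rewrite sub0r (gen0 Rf) sub0r => ->; rewrite opprK.
Qed.

Lemma genMn f x n : gen_ring f -> f (x *+ n) = f x *+ n.
Proof.
by move=> Rf; elim: n => [|n IH]; [exact: gen0|rewrite !mulrS (genD _ _ Rf) IH].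
Qed.

Lemma gen_comm f h v : gen_ring f -> gen_ring h -> f (h v) = h (f v).
Proof.
move=> Rf Rh; elim: Rf v => {f} [x ax||f k Rf IHf Rk IHk|f k _ IHf _ IHk] v //.
- elim: Rh v => {h} [y ay||f k _ IHf _ IHk|f k _ IHf _ IHk] v //.
  + apply/eqP; rewrite -subr_eq0 -rho_br a_abelian //.
    by apply/eqP; apply: (addIr (rho 0 v)); rewrite -rhoD !add0r.
  + by rewrite raddfB IHf IHk.
  + by rewrite IHf IHk.
- by rewrite IHf IHk genB.
- by rewrite IHk IHf.
Qed.

(** The commutator of [rho x] with [f]; it acts as a derivation on the generated ring. *)
Definition der x (f : V -> V) : V -> V := fun v => rho x (f v) - f (rho x v).

Lemma gen_der x f : gen_ring f -> gen_ring (der x f).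
Proof.
elim=> {f} [h ah||f h _ IHf _ IHh|f h Rf IHf Rh IHh].
- by apply: gen_ext (gen_in (a_ideal x ah)) => v; rewrite rho_br.
- by apply: gen_ext gen_zero => v; rewrite /der subrr.
- apply: gen_ext (gen_sub IHf IHh) => v; rewrite /der (raddfB (rho x)).
  by rewrite subrACA.
- apply: gen_ext (gen_add (gen_comp IHf Rh) (gen_comp Rf IHh)) => v.
  by rewrite /der genB // addrA subrK.
Qed.

(** This is the power rule for the derivation; the factors can be collected because [der x f] lies
    in the same commutative ring as [f]. *)
Lemma rho_iter x f n v : gen_ring f ->
  rho x (iter n.+1 f v) =
  iter n.+1 f (rho x v) + iter n f (der x f v) *+ n.+1.
Proof.
move=> Rf; have Rd := gen_der x Rf; elim: n => [|n IH].
  by rewrite /= mulr1n /der addrC subrK.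
have -> : rho x (iter n.+2 f v) = f (rho x (iter n.+1 f v)) + der x f (iter n.+1 f v).
  by rewrite /der addrC subrK.
rewrite IH genD // genMn //= -addrA; congr (_ + _).
have -> : der x f (f (iter n f v)) = f (iter n f (der x f v)).
  by rewrite -[f (iter n f v)]/(iter n.+1 f v) gen_comm //; exact: gen_iter.
by rewrite [RHS]mulrS addrC.
Qed.

Lemma iter_char_comm x f v : gen_ring f -> rho x (iter p f v) = iter p f (rho x v).
Proof.
by move=> Rf; rewrite -(prednK (prime_gt0 p_prime)) rho_iter //
  prednK ?prime_gt0 // Vp addr0.
Qed.

Definition nil (f : V -> V) := forall v, iter p f v = 0.

Lemma gen_dich f : gen_ring f -> nil f \/ nearly_bijective f.
Proof.
move=> Rf; have p0 := prime_gt0 p_prime.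
have [n0|[fk sf]] := schur (gen_dend (gen_iter p Rf))
  (fun x v => esym (iter_char_comm x v Rf)); first by left.
right; split=> [infK|w]; last first.
  have [v <-] := sf w; exists (iter p.-1 f v).
  by rewrite -[f _]/(iter p.-1.+1 f v) prednK.
apply: fk; apply: infinite_sub infK => v fv.
by rewrite -(prednK p0) iterSr fv gen0 //; exact: gen_iter.
Qed.

Lemma nil_der x f : gen_ring f -> nil f -> nil (der x f).
Proof.
move=> Rf nf; have [//|[fk su]] := gen_dich (gen_der x Rf).
case: V_rank; apply: (nilpotent_rank (gen_dend Rf) nf).
apply: contrapT => N.
(* Descent on the exponent: [n.+1] is invertible modulo [p] and [der x f] is surjective, so
   vanishing of [f^(n+1)] forces vanishing of [f^n], down to the identity. *)
have fn0 n : (n < p)%N -> (forall v, iter n f v = 0) -> False.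
  elim: n => [_ h|n IH lt_np fn]; first by have [v] := V_neq0; apply; exact: h.
  apply: IH (ltnW lt_np) _ => v; have [w <-] := su v.
  have := rho_iter x n w Rf; rewrite !fn raddf0 add0r => /esym E.
  have co : coprime n.+1 p by rewrite coprime_sym prime_coprime // gtnNdvd.
  have [k m mE _] := egcdnP p (ltn0Sn n); move: co mE.
  rewrite /coprime => /eqP -> mE.
  set y := iter n f _ in E *.
  have : y *+ (k * n.+1) = 0 by rewrite mulnC mulrnA E mul0rn.
  by rewrite mE mulrnDr mulnC mulrnA Vp mul0rn add0r mulr1n.
apply: (fn0 p.-1); first by rewrite prednK // prime_gt0.
by move=> v; apply: contrapT => h; apply: N; exists v.
Qed.

Definition stable_sub (U : set V) : Prop :=
  [/\ dsub cV U, infinite_group U & forall f, gen_ring f -> forall u, U u -> U (f u)].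

Lemma exists_line : exists W : set V, stable_sub W /\
  forall U, stable_sub U -> U `<=` W -> W `<=` U.
Proof.
have [||W [sW Wmin]] := @V_dcc stable_sub.
- by exists [set: V]; split; [exact: dsubT|exact: V_infinite|].
- by move=> H [].
by exists W.
Qed.

(** * A minimal infinite definable submodule for the generated ring *)

Section Line.
Variable W : set V.
Hypotheses (W_stable : stable_sub W)
  (W_min : forall U, stable_sub U -> U `<=` W -> W `<=` U).

(** By commutativity, the kernel of [f] in [W] and the image of [W] are stable. One of them is
    infinite, and minimality makes it equal to [W]. *)
Lemma line_dich f : gen_ring f ->
  (forall w, W w -> f w = 0) \/ (forall w, W w -> exists2 w', W w' & f w' = w).
Proof.
move=> Rf; have [dW infW RW] := W_stable; have [sW _] := dW.
have [fin|inf] := pselect (finite_index [set 0] (f @` W)).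
  left; suff WU : W `<=` (fun v => W v /\ f v = 0) by move=> w /WU[].
  apply: W_min => [|w []//]; have dk := dsub_ker (gen_dend Rf).
  split; first exact: dsubI.
    apply: (infinite_index _ infW); apply: finite_indexI => //.
    - by case: dk.
    - exact: finite_index_refl.
    - by apply: finite_kernel_of_image => //; exact: gen_dend.
  by move=> h Rh u [Wu fu]; split; [exact: RW|rewrite gen_comm // fu gen0].
right=> w Ww; suff [w' Ww' <-] : (f @` W) w by exists w'.
apply: W_min Ww => [|_ [u Wu <-]]; last exact: RW.
split=> //; first by apply: dsub_image => //; exact: gen_dend.
by move=> h Rh _ [u Wu <-]; exists (h u); [exact: RW|rewrite gen_comm].
Qed.

Lemma nil_line f : gen_ring f -> nil f -> forall w, W w -> f w = 0.
Proof.
move=> Rf nf; have [//|sf] := line_dich Rf.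
have [_ /infinite_neq0[w Ww w0] _] := W_stable; case: w0.
have sn n u : W u -> exists2 v, W v & iter n f v = u.
  elim: n u => [|n IH] u Wu; first by exists u.
  by have [u' Wu' <-] := sf _ Wu; have [z Wz <-] := IH _ Wu'; exists z.
by have [u _ <-] := sn p w Ww; rewrite nf.
Qed.

(** The common zeros of all nilpotent elements form a definable group by the chain condition. It
    contains the infinite [W] and is invariant by [nil_der], so it is [V]. *)
Lemma nil_eq0 f : gen_ring f -> nil f -> forall v, f v = 0.
Proof.
move=> Rf nf v; have [_ infW _] := W_stable.
pose C := [set (fun v => h v = 0) | h in [set h | gen_ring h /\ nil h]].
suff : (fun v => forall H, C H -> H v) v.
  by move/(_ (fun v => f v = 0)); apply; exists f.
apply: (irreducible_infinite (U := fun v => forall H, C H -> H v)).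
- apply: dsub_bigcap => // _ [h [Rh _] <-]; exact/dsub_ker/gen_dend.
- by apply: infinite_sub infW => w Ww _ [h [Rh nh] <-]; exact: nil_line.
- move=> x u Cu _ [h [Rh nh] <-].
  have hu : h u = 0 by apply: (Cu (fun v => h v = 0)); exists h.
  have : der x h u = 0.
    apply: (Cu (fun v => der x h v = 0)); exists (der x h) => //.
    by split; [exact: gen_der|exact: nil_der].
  by rewrite /der hu raddf0 sub0r => /eqP; rewrite oppr_eq0 => /eqP.
Qed.

Lemma gen_domain f : gen_ring f -> (forall v, f v = 0) \/ nearly_bijective f.
Proof. by move=> Rf; have [nf|] := gen_dich Rf; [left; exact: nil_eq0|right]. Qed.

Hypothesis a_infinite : infinite_group a.

Lemma rho_eq_zero x : (forall v, rho x v = 0) -> x = 0.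
Proof.
move=> x0; apply: rho_inj => v; rewrite x0; apply/esym.
by apply: (addIr (rho 0 v)); rewrite -rhoD !add0r.
Qed.

Lemma rho_nearly_bijective x : a x -> x <> 0 -> nearly_bijective (rho x).
Proof.
by move=> ax x0; have [/rho_eq_zero|] := gen_domain (gen_in ax).
Qed.

(** * Finite sums of images of the connected group [b], and the simply transitive action on the
    line *)

Variable b : set g.
Hypotheses (b_sub : dsub cg b) (ba : b `<=` a) (b_infinite : infinite_group b).
Hypothesis b_min : forall H, dsub cg H -> finite_index H b -> b `<=` H.

(* [span w [:: f_1; ...; f_n]] is the sum of the groups [f_i (b w)]. *)
Fixpoint span (w : V) (fs : seq (V -> V)) : V -> Prop :=
  if fs is f :: fs' then
    fun u => exists x, b x /\ exists u', span w fs' u' /\ u = u' + f (rho x w)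
  else fun u => u = 0.

Fixpoint all_gen (fs : seq (V -> V)) : Prop :=
  if fs is f :: fs' then gen_ring f /\ all_gen fs' else True.

Lemma rhoBl x y v : rho (x - y) v = rho x v - rho y v.
Proof. by apply: (addIr (rho y v)); rewrite -rhoD !subrK. Qed.

Lemma rho0l v : rho 0 v = 0.
Proof. by apply: (addIr (rho 0 v)); rewrite -rhoD !add0r. Qed.

Lemma span_dsub w fs : all_gen fs -> dsub cV (span w fs).
Proof.
have c_opp := dfun_opp cV_def cV_add.
elim: fs => [|f fs IH] /=; first by move=> _; exact: dsub0.
move=> [Rf /IH[sS dS]]; have [fB df] := gen_dend Rf.
have [sb db] := b_sub; split; last by dset_tac.
split=> [|_ _ [x [bx [u [Su ->]]]] [y [bY [v [Sv ->]]]]].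
  exists 0; split; first exact: subgroup0; exists 0; split; first exact: subgroup0.
  by rewrite rho0l gen0 // add0r.
exists (x - y); split; first exact: subgroupB.
exists (u - v); split; first exact: subgroupB.
by rewrite rhoBl fB opprD addrACA.
Qed.

Lemma span_gen w fs u : all_gen fs -> span w fs u ->
  exists2 f, gen_ring f & u = f w.
Proof.
elim: fs u => [|f fs IH] u /=.
  by move=> _ ->; exists (fun=> 0) => //; exact: gen_zero.
move=> [Rf Rfs] [x [bx [u' [Su ->]]]]; have [h Rh ->] := IH _ Rfs Su.
exists (fun v => h v + f (rho x v)) => //; apply: gen_add => //.
by apply: gen_comp => //; apply: gen_in; exact: ba.
Qed.

Lemma span_stable w fs : all_gen fs ->
  (forall f, gen_ring f -> forall x, b x -> span w fs (f (rho x w))) ->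
  forall f, gen_ring f -> forall u, span w fs u -> span w fs (f u).
Proof.
move=> Rfs all_in f Rf u; have [sS _] := span_dsub w Rfs.
suff H hs : all_gen hs -> forall u, span w hs u -> span w fs (f u) by exact: H.
elim: hs => [|h hs IH] /= Rhs {}u.
  by move=> ->; rewrite gen0 //; exact: subgroup0.
case: Rhs => Rh Rhs [x [bx [u' [Su ->]]]].
rewrite (genD _ _ Rf); apply: subgroupD => //; first exact: IH.
by apply: (all_in (fun v => f (h v))) => //; exact: gen_comp.
Qed.

(** Choose [fs] with a span of maximal rank, which is bounded by [p]. One more [f] can enlarge the
    span only by finite index, and connectedness of [b] puts [f (b w)] inside it already. *)
Lemma exists_span w : exists2 fs, all_gen fs &
  forall f, gen_ring f -> forall x, b x -> span w fs (f (rho x w)).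
Proof.
pose P k := `[< exists2 fs, all_gen fs & rank_ge cV k (span w fs) >].
have P0 : exists k, P k by exists 0%N; apply/asboolP; exists [::] => //; exists 0.
have Pmax k : P k -> (k <= p)%N.
  move=> /asboolP[fs _ rk]; rewrite leqNgt; apply/negP => lt_pk; apply: V_rank.
  by apply: rank_ge_sub (rank_ge_le (ltnW lt_pk) rk).
case: (ex_maxnP P0 Pmax) => k /asboolP[fs Rfs rk] kmax.
exists fs => // f Rf.
have Rffs : all_gen (f :: fs) by [].
have dS := span_dsub w Rfs; have dS' := span_dsub w Rffs.
have [sb db] := b_sub; have [sS dsS] := dS; have [sS' dsS'] := dS'.
have fin : finite_index (span w fs) (span w (f :: fs)).
  apply: contrapT => nfin.
  have /kmax : P k.+1; last by rewrite ltnn.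
  apply/asboolP; exists (f :: fs) => //.
  apply: (rank_ge_index cV_def cV_add dS sS' _ nfin rk) => u Su.
  exists 0; split; first exact: subgroup0; exists u; split=> //.
  by rewrite rho0l gen0 // addr0.
pose F x := f (rho x w).
have FB : {morph F : x y / x - y} by move=> x y; rewrite /F rhoBl genB.
have dF : dfun cg cV F.
  by have [_ df] := gen_dend Rf; rewrite /F; dset_tac.
suff : b `<=` (fun x => span w fs (F x)) by [].
apply: b_min.
  by split; [exact: subgroup_preim|dset_tac].
apply: (finite_index_preim FB sS _ fin) => x bx.
exists x; split=> //; exists 0; split; first exact: subgroup0.
by rewrite add0r.
Qed.

(** The span is a stable subgroup of [W]. It is infinite, since otherwise the connected [b] would
    annihilate [w]; so minimality applies. *)
Lemma line_span w fs : W w -> all_gen fs ->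
  (forall f, gen_ring f -> forall x, b x -> span w fs (f (rho x w))) ->
  (exists2 x, b x & rho x w <> 0) -> W `<=` span w fs.
Proof.
move=> Ww Rfs all_in [x bx xw]; apply: W_min.
  have dS := span_dsub w Rfs; split=> //; last exact: span_stable.
  move=> fin; apply: xw; pose F y := rho y w.
  have dF : dfun cg cV F by rewrite /F; dset_tac.
  have FB : {morph F : y z / y - z} by move=> y z; exact: rhoBl.
  suff : b `<=` (fun y => F y = 0) by move/(_ x bx).
  have [_ d0] := dsub0; apply: b_min.
    split; first by exact: (subgroup_preim FB (subgroup1 V)).
    by apply: (dset_eq (d := cV)); dset_tac.
  apply: (finite_index_preim FB _ _ fin); first exact: subgroup1.
  by move=> y; exact: (all_in id gen_id).
move=> u /(span_gen Rfs)[f Rf ->]; have [_ _ RW] := W_stable; exact: RW.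
Qed.

(** If [b] did not kill [w], every point of [W] would be of the form [h w], and [f] would kill the
    infinite [W]. *)
Lemma gen_torsion w f : W w -> gen_ring f -> f w = 0 -> nearly_bijective f ->
  forall x, b x -> rho x w = 0.
Proof.
move=> Ww Rf fw [fk _] x bx; apply: contrapT => xw; apply: fk.
have [fs Rfs all_in] := exists_span w.
have [_ infW _] := W_stable; apply: infinite_sub infW => u Wu.
have [|h Rh ->] := span_gen Rfs (line_span Ww Rfs all_in _ Wu); first by exists x.
by rewrite gen_comm // fw gen0.
Qed.

(** Write [w = x w'] with [x] nonzero in [b]. The square of [x] kills [w'] and is nearly bijective,
    so [gen_torsion] shows that [b] kills [w']; in particular [w = x w' = 0]. *)
Lemma b_torsion_free w : W w -> (forall x, b x -> rho x w = 0) -> w = 0.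
Proof.
move=> Ww bw; have [x bx x0] := infinite_neq0 b_infinite.
have Rx := gen_in (ba bx); have [xk sx] := rho_nearly_bijective (ba bx) x0.
have [w' Ww' w'w] : exists2 w', W w' & rho x w' = w.
  have [x0'|sW] := line_dich Rx; last exact: sW.
  have [_ infW _] := W_stable; case: xk; exact: infinite_sub infW.
rewrite -w'w; apply: (gen_torsion Ww' (gen_comp Rx Rx)) => //.
  by rewrite w'w bw.
have [/(_ _)h|//] := gen_domain (gen_comp Rx Rx).
have [v v0] := V_neq0; case: v0.
by have [u <-] := sx v; have [z <-] := sx u; exact: h.
Qed.

Lemma line_free w f : W w -> w <> 0 -> gen_ring f -> f w = 0 -> forall v, f v = 0.
Proof.
move=> Ww w0 Rf fw; have [//|nf] := gen_domain Rf.
by case: w0; apply: b_torsion_free => //; exact: gen_torsion nf.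
Qed.

Lemma line_unique w f h : W w -> w <> 0 -> gen_ring f -> gen_ring h ->
  f w = h w -> f =1 h.
Proof.
move=> Ww w0 Rf Rh E v; apply/eqP; rewrite -subr_eq0; apply/eqP.
by apply: (line_free Ww w0 (gen_sub Rf Rh)); rewrite E subrr.
Qed.

Lemma line_eq_span w fs : W w -> w <> 0 -> all_gen fs ->
  (forall f, gen_ring f -> forall x, b x -> span w fs (f (rho x w))) ->
  W `<=` span w fs.
Proof.
move=> Ww w0 Rfs all_in; apply: line_span => //.
apply: contrapT => N; apply: w0; apply: b_torsion_free => // x bx.
by apply: contrapT => xw; apply: N; exists x.
Qed.

Lemma line_transitive w u : W w -> w <> 0 -> W u -> exists2 f, gen_ring f & u = f w.
Proof.
move=> Ww w0 Wu; have [fs Rfs all_in] := exists_span w.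
exact: span_gen Rfs (line_eq_span Ww w0 Rfs all_in Wu).
Qed.

(* The graph of the action on [V] of the element [f] of the ring with
   [f w = u], uniformly in [u]. *)
Lemma line_graph w : W w -> w <> 0 ->
  dset (coord_pair cV (coord_pair cV cV)) (fun t => W t.1 /\
    exists f, [/\ gen_ring f, f w = t.1 & f t.2.1 = t.2.2]).
Proof.
move=> Ww w0; have [fs Rfs all_in] := exists_span w.
(* For [t = (u, (v, v'))], one choice of elements [x_i] of [b] gives both [u], as the sum of the
   [h_i (x_i w)], and [v'], as the sum of the [h_i (x_i v)]. *)
pose G := fix G hs (t : V * (V * V)) : Prop := if hs is h :: hs' then
    exists x, b x /\ exists t' : V * (V * V), G hs' t' /\ [/\ t.2.1 = t'.2.1,
      t.1 = t'.1 + h (rho x w) & t.2.2 = t'.2.2 + h (rho x t.2.1)]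
  else t.1 = 0 /\ t.2.2 = 0.
have c_opp := dfun_opp cV_def cV_add; have [_ db] := b_sub.
have dG hs : all_gen hs -> dset (coord_pair cV (coord_pair cV cV)) (G hs).
  elim: hs => [|h hs IH] Rhs; first by cbn [G]; dset_tac.
  have [/gen_dend[_ dh] {}/IH dG] := Rhs.
  have ct : dtype (coord_pair cV (coord_pair cV cV)) by dset_tac.
  cbn [G].
  apply: (dset_ext (P := fun t : V * (V * V) => exists x, b x /\
     exists t' : V * (V * V), G hs t' /\ (t.2.1 = t'.2.1 /\
     (t.1 = t'.1 + h (rho x w) /\ t.2.2 = t'.2.2 + h (rho x t.2.1))))).
    move=> t; split=> -[x [bx [t' [Gt' H]]]]; exists x; split=> //; exists t';
     by split=> //; move: H => [? [? ?]] || move: H => [? ? ?].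
  dset_tac.
have GP hs t : all_gen hs -> G hs t <-> span w hs t.1 /\
    exists f, [/\ gen_ring f, f w = t.1 & f t.2.1 = t.2.2].
  move=> Rhs; elim: hs Rhs t => [|h hs IH] Rhs [u [v v']] /=.
    split=> [[-> ->]|[-> [f [Rf fw <-]]]].
      by split=> //; exists (fun=> 0); split=> //; exact: gen_zero.
    by split=> //; exact: (line_free Ww w0 Rf fw).
  have [Rh {}Rhs] := Rhs.
  split=> [[x [bx [[u1 [v1 v1']] [/(IH Rhs)/= [Su1 [f [Rf fw fv]]] [-> -> ->]]]]]|].
    split; first by exists x; split=> //; exists u1.
    exists (fun z => f z + h (rho x z)); split; [|by rewrite fw|by rewrite fv].
    by apply: gen_add => //; apply: gen_comp => //; exact/gen_in/ba.
  move=> [[x [bx [u1 [Su1 ->]]]] [f [Rf fw <-]]]; exists x; split=> //.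
  have [f1 Rf1 u1E] := span_gen Rhs Su1.
  exists (u1, (v, f1 v)); split; first by apply/(IH Rhs); split=> //; exists f1.
  split=> //=; have Rx : gen_ring (fun z => f1 z + h (rho x z)).
    by apply: gen_add => //; apply: gen_comp => //; exact/gen_in/ba.
  by apply: (line_unique Ww w0 Rf Rx); rewrite fw u1E.
have [[_ dW] _ _] := W_stable.
have dGfs := dG fs Rfs.
apply: (dset_ext (P := fun t => W t.1 /\ G fs t)); last by dset_tac.
move=> t; split=> -[Wt H]; split=> //; first by have /(GP _ _ Rfs)[] := H.
by apply/(GP _ _ Rfs); split=> //; exact: line_eq_span.
Qed.

(** A point [u] of [W] stands for the unique ring element [F u] taking the base point [w] to [u].
    Each identity between ring elements is then checked at [w] only. *)
Lemma exists_scalar_line : exists l : scalar_line V,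
  [/\ infinite_group (sl_set l), dset cV (sl_set l),
      dset (coord_pair cV (coord_pair cV cV))
        (fun t => sl_set l t.1 /\ sl_act l t.1 t.2.1 = t.2.2),
      forall u, gen_ring (sl_act l u)
    & forall f, gen_ring f -> exists2 u, sl_set l u & f =1 sl_act l u].
Proof.
have [[sW dW] infW RW] := W_stable.
have [w Ww w0] := infinite_neq0 infW.
(* Off [W] the default is the identity, which keeps every [F u] in the ring. *)
have ex_act u : exists f, gen_ring f /\ (W u -> f w = u).
  have [Wu|nWu] := pselect (W u); last by exists id; split=> //; exact: gen_id.
  by have [f Rf ->] := line_transitive Ww w0 Wu; exists f.
have [F FP] := choice ex_act.
have RF u : gen_ring (F u) by case: (FP u).
have Fw u : W u -> F u w = u by case: (FP u).
have uniq f u : gen_ring f -> W u -> f w = u -> f =1 F u.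
  by move=> Rf Wu fw; apply: (line_unique Ww w0) => //; rewrite fw Fw.
have Fin u v : W u -> W v -> W (F u v) by move=> _; exact: RW.
have Faddl u u' v : W u -> W u' -> F (u + u') v = F u v + F u' v.
  move=> Wu Wu'; apply/esym.
  apply: (uniq (fun v => F u v + F u' v)); first exact: gen_add.
    exact: subgroupD.
  by rewrite !Fw.
have Faddr u v v' : W u -> F u (v + v') = F u v + F u v' by move=> _; exact: genD.
have Fassoc u u' v : W u -> W u' -> F u (F u' v) = F (F u u') v.
  move=> Wu Wu'; apply: (uniq (fun v => F u (F u' v))); first exact: gen_comp.
    exact: Fin.
  by rewrite Fw.
have F1 v : F w v = v.
  by apply/esym; apply: (uniq id) => //; exact: gen_id.
have Fcomm u u' : W u -> W u' -> F u u' = F u' u.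
  by move=> Wu Wu'; rewrite -{1}(Fw _ Wu') gen_comm // Fw.
have Finv u : W u -> u <> 0 -> exists u', W u' /\ F u' u = w.
  move=> Wu u0; have [f Rf wE] := line_transitive Wu u0 Ww.
  exists (f w); split; first exact: RW.
  by rewrite {2}wE; apply/esym; apply: uniq => //; exact: RW.
exists (ScalarLine sW Ww w0 Fin Faddl Faddr Fassoc F1 Fcomm Finv) => /=.
split=> //.
- apply: dset_ext (line_graph Ww w0) => -[u [v v']] /=.
  split=> -[Wu]; last by move=> <-; split=> //; exists (F u); rewrite Fw.
  by move=> [f [Rf fw <-]]; split=> //; apply/esym; exact: uniq.
- by move=> f Rf; exists (f w); [exact: RW|apply: uniq => //; exact: RW].
Qed.

(** By perfectness a scalar is a [p]-th power, so it acts as a [p]-fold iterate of a ring element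
    and commutes with [g] by [iter_char_comm]. *)
Lemma exists_scalars : exists l : scalar_line V,
  [/\ infinite_group (sl_set l), dset cV (sl_set l),
      dset (coord_pair cV (coord_pair cV cV))
        (fun t => sl_set l t.1 /\ sl_act l t.1 t.2.1 = t.2.2),
      forall u x v, sl_set l u -> rho x (sl_act l u v) = sl_act l u (rho x v)
    & forall x, a x -> exists2 u, sl_set l u & rho x =1 sl_act l u].
Proof.
have [l [infl dl dact Rl genl]] := exists_scalar_line.
exists l; split=> //; last by move=> x /gen_in; exact: genl.
move=> u x v lu.
have [k' kE] := sf_perfect cV_def cV_add dl dact p_prime Vp V_dcc (sf lu).
have val_exp n w : sl_act l (sf_val (k' ^+ n)) w = iter n (sl_act l (sf_val k')) w.
  elim: n w => [|n IH] w; first exact: sl_act1.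
  by rewrite exprS /= -sl_assoc ?IH //; exact: sfP.
have -> : u = sf_val (k' ^+ p) by rewrite -kE.
by rewrite !val_exp iter_char_comm.
Qed.

End Line.
End Ring.

(** * Abelian ideals *)

Section Centralizers.
Variable g : lieRingType.
Implicit Types (x y z : g) (S : set g).

Lemma bracket0r x : bracket x 0 = 0.
Proof. by apply: (addIr (bracket x 0)); rewrite -bracketDr !add0r. Qed.

Lemma bracket0l x : bracket 0 x = 0.
Proof. by apply: (addIr (bracket 0 x)); rewrite -bracketDl !add0r. Qed.

Lemma bracketBl x y z : bracket (x - y) z = bracket x z - bracket y z.
Proof. by apply: (addIr (bracket y z)); rewrite -bracketDl !subrK. Qed.

Lemma bracketC x y : bracket x y = - bracket y x.
Proof.
apply/eqP; rewrite -addr_eq0; apply/eqP; have := bracketxx (x + y).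
by rewrite bracketDl !bracketDr !bracketxx add0r addr0.
Qed.

Definition lie_centralizer S : set g := fun x => forall y, S y -> bracket x y = 0.

Lemma lie_centralizer_bracket S : (forall x y, S y -> S (bracket x y)) ->
  forall x y, lie_centralizer S y -> lie_centralizer S (bracket x y).
Proof.
move=> S_ideal x y cy z Sz; have := jacobi x y z.
rewrite (cy _ Sz) bracket0r add0r [bracket z x]bracketC.
have -> : bracket y (- bracket x z) = 0.
  have := bracketDr y (bracket x z) (- bracket x z).
  by rewrite subrr bracket0r cy ?add0r //; exact: S_ideal.
by rewrite add0r bracketC => /eqP; rewrite oppr_eq0 => /eqP.
Qed.

Lemma subgroup_lie_centralizer S : subgroup (lie_centralizer S).
Proof.
split=> [y _|x y cx cy z Sz]; first exact: bracket0l.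
by rewrite bracketBl cx // cy // subrr.
Qed.

End Centralizers.

(* The ideal is the center of the centralizer of [a]. *)
Lemma definable_abelian_ideal (L : language) (M : structure L) (g : lieRingType)
    (cg : coordinates M g) (a : set g) :
  definable_lie_ring cg -> dcc cg -> lie_ideal a -> lie_abelian a ->
  exists a' : set g, [/\ dsub cg a', a `<=` a', lie_ideal a' & lie_abelian a'].
Proof.
move=> [[cg_def cg_add] cg_br] g_dcc [sa a_ideal] a_ab.
change (dtype cg) in cg_def.
set c := lie_centralizer a.
have dc : dsub cg c.
  have -> : c = (fun x => forall H, [set (fun x => bracket x y = 0) | y in a] H -> H x).
    apply/seteqP; split=> [x cx _ [y ay <-]|x H y ay]; first exact: cx.
    by apply: (H (fun x => bracket x y = 0)); exists y.
  apply: dsub_bigcap => // _ [y ay <-]; split; last by dset_tac.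
  split=> [|u v hu hv]; first exact: bracket0l.
  by rewrite bracketBl hu hv subrr.
have [sc dsc] := dc.
exists (fun x => c x /\ lie_centralizer c x); split.
- split; first by apply: subgroupI => //; exact: subgroup_lie_centralizer.
  by rewrite /lie_centralizer; dset_tac.
- move=> x ax; split=> y h; first exact: a_ab.
  by rewrite bracketC h // oppr0.
- split; first by apply: subgroupI => //; exact: subgroup_lie_centralizer.
  have c_ideal := lie_centralizer_bracket a_ideal.
  move=> x y [cy ccy]; split; first exact: c_ideal.
  exact: lie_centralizer_bracket.
- by move=> x y [_ ccx] [cy _]; exact: ccx.
Qed.

(** The extension is the one witnessing rank at least [r]; rank [r.+1] there would witness rank at
    least [r.+1] for [X]. *)
Lemma saturated_extension (L : language) (M : structure L) (n r : nat)
    (X : set (n.-tuple M)) : morley_rank X r ->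
  exists (phi : formula L) (e : nat -> M) (N : structure L) (f : M -> N),
    [/\ X = solutions phi e, elementary_embedding f, aleph0_saturated N
      & ~ rank_ge_in r.+1 (@solutions L N n phi (f \o e))].
Proof.
move=> [[phi [e [XE [N [f [f_el N_sat _]]]]]] nrk].
exists phi, e, N, f; split=> // rk; apply: nrk.
by exists phi, e; split=> //; exists N, f.
Qed.

(** * Definable linearity from scalars commuting with the Lie ring *)

Section ScalarRestriction.
Variables (L : language) (M : structure L) (g : lieRingType) (V : zmodType)
  (cg : coordinates M g) (cV : coordinates M V) (rho : g -> {additive V -> V})
  (a : set g) (l : scalar_line V).
Hypotheses (V_act : definable_action cg cV rho) (rho_inj : faithful rho).
Hypotheses (l_inf : infinite_group (sl_set l)) (l_def : dset cV (sl_set l)).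
Hypothesis act_def : dset (coord_pair cV (coord_pair cV cV))
  (fun t => sl_set l t.1 /\ sl_act l t.1 t.2.1 = t.2.2).
Hypothesis act_comm : forall u x v, sl_set l u ->
  rho x (sl_act l u v) = sl_act l u (rho x v).
Hypothesis a_scalar : forall x, a x ->
  exists2 u, sl_set l u & rho x =1 sl_act l u.

Lemma scalars_central : a `<=` lie_center g.
Proof.
have [_ _ [rhoD rho_br] _] := V_act.
move=> x ax y; apply: rho_inj => v.
have [u lu xE] := a_scalar ax.
rewrite rho_br !xE act_comm // subrr; apply/esym.
by apply: (addIr (rho 0 v)); rewrite -rhoD !add0r.
Qed.

Lemma scalars_definably_linear : definably_linear cg cV rho a.
Proof.
have [[[cg_def cg_add] cg_br] [cV_def cV_add] rho_act rho_def] := V_act.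
change (dtype cg) in cg_def; change (dtype cV) in cV_def.
have dK := sf_dtype l_def; have [_ dmul] := sf_definable_field cV_add l_def act_def.
have dscale := sf_definable_scale cV_def l_def act_def.
exists (scalar_field l), (sf_coord l cV), (sf_scaling l); split.
- move=> finK; have /infinite_groupP := l_inf; apply.
  apply: (sub_finite_set _ (finite_image (@sf_val V l) finK)) => u lu.
  by exists (sf lu).
- exact: sf_definable_field.
- exact: dscale.
have ex_iota x : exists h : {linear vector_space (sf_scaling l) -> vector_space (sf_scaling l)},
    forall v, h v = rho x v.
  have lin : linear (rho x : vector_space (sf_scaling l) -> vector_space (sf_scaling l)).
    by move=> k u v; rewrite (raddfD (rho x)); congr (_ + _); apply: act_comm; exact: sfP.
  pose h := GRing.isLinear.Build _ _ _ _ _ lin.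
  by exists (HB.pack_for {linear vector_space (sf_scaling l) -> vector_space (sf_scaling l)}
    (rho x : vector_space (sf_scaling l) -> vector_space (sf_scaling l)) h).
have [iota iotaE] := choice ex_iota.
have iotaA x v : (iota x : {additive vector_space (sf_scaling l) ->
    vector_space (sf_scaling l)}) v = rho x v := iotaE x v.
exists iota; split.
- split=> //.
    by case: rho_act => rhoD rho_br; split=> x y v; rewrite !iotaA.
  have : definable_fun2 cg cV cV (fun x v => rho x v) by [].
  by apply: dset_ext => -[[x v] v'] /=; rewrite iotaA.
- by move=> x y E; apply: rho_inj => v; rewrite -!iotaA E.
- by [].
pose scalar x (k : scalar_field l) := forall v, rho x v = sf_scale k v.
(* By commutativity a scalar sends the base point to its own value, so its action determines it. *)
have scalar_uniq x k k' : scalar x k -> scalar x k' -> k = k'.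
  move=> h h'; have := h (sl_one l); rewrite h'.
  rewrite /sf_scale sl_comm ?sl_act1; [|exact: sfP|exact: sl_one_in].
  rewrite sl_comm ?sl_act1; [|exact: sfP|exact: sl_one_in].
  by move=> E; apply: val_inj.
(* [lambda] must be definable on all of [g]: it is the scalar by which [x] acts, if any, and 0
   otherwise, a condition that does not mention [a]. *)
have ex_lambda x : exists k, scalar x k \/ (~ exists k', scalar x k') /\ k = 0.
  have [[k h]|n] := pselect (exists k, scalar x k); first by exists k; left.
  by exists 0; right.
have [lambda lambdaP] := choice ex_lambda.
exists lambda.
  apply: (dset_ext (P := fun u : g * scalar_field l =>
    scalar u.1 u.2 \/ (~ exists k', scalar u.1 k') /\ u.2 = 0)).
    move=> [x k] /=; split=> [|<-]; last exact: lambdaP.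
    move=> [h|[n ->]]; case: (lambdaP x) => [h'|[n' h']] //.
    - exact: scalar_uniq h' h.
    - by case: n'; exists k.
    - by case: n; exists (lambda x).
  by rewrite /scalar; dset_tac.
move=> x ax v; rewrite iotaE.
have [u lu xE] := a_scalar ax.
case: (lambdaP x) => [h|[n _]]; first exact: h.
by case: n; exists (sf lu) => w; rewrite xE.
Qed.

End ScalarRestriction.

(** * Chain conditions, enlargement of the ideal and conclusion *)

Theorem theorem1 (L : language) (M : structure L)
  (M_fmr : finite_morley_rank M)
  (g : lieRingType) (cg : coordinates M g) (g_def : definable_lie_ring cg)
  (V : zmodType) (cV : coordinates M V) (rho : g -> {additive V -> V})
  (V_mod : definable_module cg cV rho)
  (V_irr : irreducible_module cV rho)
  (V_faithful : faithful rho)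
  (p r : nat) (V_char : module_char V p) (V_rank : morley_rank (range cV) r)
  (lt_r_p : (r < p)%N)
  (a : set g) (a_inf : infinite_set a) (a_ideal : lie_ideal a)
  (a_abelian : lie_abelian a) :
  a `<=` lie_center g /\ definably_linear cg cV rho a.
Proof.
have [V_act V_conn] := V_mod.
have [_ [cV_def cV_add] rho_act rho_def] := V_act.
have [[cg_def cg_add] cg_br] := g_def.
change (dtype cg) in cg_def; change (dtype cV) in cV_def.
(* Characteristic 0 is excluded by [r < p]. *)
have [[p_prime [v0 v0_neq0] Vp]|[p0 _]] := V_char; last by rewrite p0 in lt_r_p.
have V_neq0 : exists v : V, v <> 0 by exists v0; apply/eqP.
have [phi [e [N [f [XE f_el N_sat nrk]]]]] := saturated_extension V_rank.
(* As [r.+1 <= p], rank [p] witnessed in [M] would transfer to rank [r.+1] in [N]. *)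
have V_rank' : ~ rank_ge cV p [set: V].
  move=> /(rank_ge_le lt_r_p)/rank_ge_coord rk; apply: nrk.
  by apply: (rank_ge_transfer f_el); rewrite -XE.
have V_dcc := dcc_of_rank cV_def cV_add V_rank'.
have V_ladder (E : V * g -> Prop) : dset (coord_pair cV cg) E ->
    forall (v : nat -> V) (x : nat -> g), ~ forall i j, E (v i, x j) <-> (i <= j)%N.
  move=> dE v x H.
  apply: (no_ladder f_el N_sat nrk dE (t := fun i => cV (v i)) (b := fun j => cg (x j))).
    by move=> i; rewrite -XE; exists (v i).
  move=> i j; rewrite -H; split=> [[u Eu E_u]|h].
    by rewrite -(@coord_inj _ _ _ (coord_pair cV cg) u (v i, x j) E_u).
  by exists (v i, x j).
have [rhoD _] := rho_act.
have g_dcc : dcc cg := lie_dcc cg_def cV_def rho_def rhoD V_faithful V_ladder V_dcc.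
(* [a] need not be definable, so the argument runs with a definable abelian ideal containing it,
   whose scalars then serve for [a]. *)
have [a' [da' aa' [sa' a'_ideal] a'_ab]] :=
  definable_abelian_ideal g_def g_dcc a_ideal a_abelian.
have [W [W_stable W_min]] := exists_line rho cV_def cV_add V_dcc V_conn V_neq0 a'.
have [b [db ba' fb b_min]] := connected_component g_dcc da'.
have b_inf : infinite_group b.
  apply: infinite_index fb _; apply/infinite_groupP.
  by move=> fin; apply: a_inf; exact: sub_finite_set fin.
have [l [l_inf l_def act_def act_comm a'_scalar]] := exists_scalars cg_def
  cV_def cV_add rho_def rho_act V_faithful V_dcc V_conn V_irr V_neq0 p_prime Vp
  V_rank' a'_ideal a'_ab W_stable W_min db ba' b_inf b_min.
have a_scalar x (ax : a x) := a'_scalar x (aa' x ax).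
by split; [exact: (scalars_central V_act V_faithful act_comm a_scalar)
          |exact: (scalars_definably_linear V_act V_faithful l_inf l_def)].
Qed.
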